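(* For every $d\in\mathbb{N}$ there is a constant $c_d>0$ depending only on $d$ such that the following holds. Let $\eta$ be a non-trivial Poisson point process on $\mathbb{R}^d$ with locally finite and non-atomic intensity measure $\mu$. Let $\rho>0$ and consider the random geometric graph $G_\rho(\eta)$ with vertex set $\eta$ and an edge between distinct $x,y\in\eta$ whenever $\lVert x-y\rVert\le\rho$. Assume $$\sigma_\rho^\mu=\sup_{x\in\mathbb{R}^d}\mu(B(x,\rho))<\infty .$$ Let $k\in\mathbb{N}$ and let $F$ be one of the following: (i) the number of components of $G_\rho(\eta)$ with at most $k$ vertices; (ii) the number of components of $G_\rho(\eta)$ with exactly $k$ vertices; (iii) the number of components of $G_\rho(\eta)$ that are isomorphic to some fixed connected graph $H$ on $k$ vertices. Assume that $F$ is almost surely finite and that $\mathbb{E}F>0$. Then $F$ is integrable and for any $r\ge 0$, $$\mathbb{P}(F\ge \mathbb{E}F+r)\le \exp\left(-\frac{r^2}{a(2\,\mathbb{E}F+r)}\right),\qquad \mathbb{P}(F\le \mathbb{E}F-r)\le \exp\left(-\frac{r^2}{2\max(a,4c_d/3)\,\mathbb{E}F}\right),$$ where $$a=k\left(c_d^2\,\sigma_\rho^\mu+1\right).$$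
   Context: $\lVert\cdot\rVert$ is the Euclidean norm and $B(x,\rho)$ is the closed Euclidean ball centered at $x$ with radius $\rho$. A Poisson point process $\eta$ with intensity measure $\mu$ is a random locally finite subset of $\mathbb{R}^d$ (equivalently, a random locally finite simple counting measure) such that the numbers of points in disjoint Borel sets are independent and the number of points $\eta(A)$ in a Borel set $A$ is Poisson distributed with parameter $\mu(A)$, where a Poisson random variable with infinite mean is almost surely $\infty$. Non-trivial means $\mu\neq 0$; $\mu$ may be infinite. A (connected) component of a graph $G=(V,E)$ is a (non-empty) connected induced subgraph with vertex set $V'\subseteq V$ such that there is no edge of $G$ between a point of $V'$ and a point of $V\setminus V'$. *)

(* Defs.v *)
From HB Require Import structures.
From mathcomp Require Import all_boot all_order all_algebra.
From mathcomp Require Import all_classical all_reals all_analysis.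
From mathcomp Require Import measurable_realfun.
Set Implicit Arguments.
Unset Strict Implicit.
Unset Printing Implicit Defensive.
Import Order.TTheory GRing.Theory Num.Theory.
Import numFieldNormedType.Exports.
Local Open Scope classical_set_scope.
Local Open Scope ring_scope.

(* The library norm on 'rV[R]_d is the sup norm: it induces the topology and
   the bounded sets of R^d, but the metric of the problem is Euclidean. *)
Definition enorm (R : realType) (d : nat) (x : 'rV[R]_d) : R :=
  Num.sqrt (\sum_(i < d) x ord0 i ^+ 2).

Definition closed_eball (R : realType) (d : nat) (x : 'rV[R]_d) (rho : R) :
  set 'rV[R]_d := [set y | enorm (y - x) <= rho].

Definition borelRd (R : realType) (d : nat) :=
  g_sigma_algebraType (@open 'rV[R]_d).

Section measures_on_Rd.
Context {R : realType} {d : nat}.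
Local Open Scope ereal_scope.
Implicit Type mu : {measure set (borelRd R d) -> \bar R}.

Definition nontrivial mu : Prop :=
  exists A : set (borelRd R d), measurable A /\ mu A != 0.

Definition locally_finite_measure mu : Prop :=
  forall A : set (borelRd R d),
    measurable A -> bounded_set (A : set 'rV[R]_d) -> mu A < +oo.

Definition atom mu (A : set (borelRd R d)) : Prop :=
  [/\ measurable A, 0 < mu A &
      forall B : set (borelRd R d),
        measurable B -> B `<=` A -> mu B = 0 \/ mu B = mu A].

Definition non_atomic mu : Prop := forall A, ~ atom mu A.

Definition sup_ball_measure mu (rho : R) : \bar R :=
  ereal_sup [set mu (closed_eball x rho) | x in [set: 'rV[R]_d]].

End measures_on_Rd.

Section poisson.
Context {R : realType} {disp : measure_display} {Omega : measurableType disp}.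
Variable P : probability Omega R.
Local Open Scope ereal_scope.

Definition independent_family (I : finType) (X : I -> Omega -> \bar R) : Prop :=
  forall C : I -> set (\bar R), (forall i, measurable (C i)) ->
    P (\bigcap_(i in [set: I]) (X i @^-1` C i)) =
    \prod_(i : I) P (X i @^-1` C i).

(* The nat argument 0 of poisson_prob is a dummy, unused by the library. *)
Definition poisson_distributed (X : Omega -> \bar R) (m : \bar R) : Prop :=
  if m == +oo then {ae P, forall w, X w = +oo}
  else forall n : nat,
    P [set w | X w = n%:R%:E] = poisson_prob (fine m) 0%N [set n].

Definition point_count (d : nat) (eta : Omega -> set 'rV[R]_d)
    (A : set 'rV[R]_d) (w : Omega) : \bar R :=
  counting (eta w `&` A).

Record poisson_process (d : nat) (mu : {measure set (borelRd R d) -> \bar R})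
    (eta : Omega -> set 'rV[R]_d) : Prop := PoissonProcess {
  pp_locally_finite : forall w (A : set 'rV[R]_d),
    bounded_set A -> finite_set (eta w `&` A) ;
  pp_measurable : forall A : set (borelRd R d), measurable A ->
    measurable_fun [set: Omega] (point_count eta A) ;
  pp_independent : forall (n : nat) (A : 'I_n -> set (borelRd R d)),
    (forall i, measurable (A i)) -> trivIset setT A ->
    independent_family (fun i => point_count eta (A i)) ;
  pp_poisson : forall A : set (borelRd R d), measurable A ->
    poisson_distributed (point_count eta A) (mu A) }.

End poisson.

(* A graph is given by its vertex set and an adjacency relation on the ambient
   type; only adjacency between vertices matters, so (C, E) with C `<=` V is
   the subgraph of (V, E) induced by C. *)
Section graphs.

Definition graph_connected (T : Type) (V : set T) (E : T -> T -> Prop) : Prop :=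
  forall x y, V x -> V y ->
    exists s : seq T,
      path (fun u v => `[< V v /\ E u v >]) x s /\ last x s = y.

Definition component (T : Type) (V : set T) (E : T -> T -> Prop) (C : set T) :
    Prop :=
  [/\ C !=set0, C `<=` V, graph_connected C E &
      forall x y, C x -> V y -> ~ C y -> ~ E x y].

Definition graph_isomorphic (T U : Type) (V : set T) (E : T -> T -> Prop)
    (W : set U) (E' : U -> U -> Prop) : Prop :=
  exists f : T -> U, set_bij V W f /\
    forall x y, V x -> V y -> (E x y <-> E' (f x) (f y)).

End graphs.

Section component_counts.
Context {R : realType} {d : nat}.
Implicit Types (rho : R) (V : set 'rV[R]_d).

Definition rgg_edge rho (x y : 'rV[R]_d) : Prop :=
  x <> y /\ enorm (x - y) <= rho.

Definition num_components_le rho (k : nat) V : \bar R :=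
  counting [set C | component V (rgg_edge rho) C /\ (C #<= `I_k)%card].

Definition num_components_eq rho (k : nat) V : \bar R :=
  counting [set C | component V (rgg_edge rho) C /\ (C #= `I_k)%card].

Definition num_components_iso rho (W : finType) (H : rel W) V : \bar R :=
  counting [set C | component V (rgg_edge rho) C /\
                    graph_isomorphic [set: W] H C (rgg_edge rho)].

End component_counts.

(* Main.v *)
Require Import Defs.
From HB Require Import structures.
From mathcomp Require Import all_boot all_order all_algebra.
From mathcomp Require Import all_classical all_reals all_analysis.
From mathcomp Require Import measurable_realfun.
From mathcomp Require Import ring lra.
Set Implicit Arguments.
Unset Strict Implicit.
Unset Printing Implicit Defensive.
Import Order.TTheory GRing.Theory Num.Theory.
Import numFieldNormedType.Exports.
Local Open Scope classical_set_scope.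
Local Open Scope ring_scope.

(* The entropy method on a discretisation.  Cut a bounded window into small
   cells.  By independence over disjoint sets, the set of occupied cells is a
   Bernoulli product whose parameters are at most the masses of the cells.
   Join two cells when they contain points at distance at most rho: for a fixed
   realisation and a fine enough mesh, the graph of occupied cells is isomorphic
   to the geometric graph in the window.

   Let f be the number of components of the given kind.  Deleting a vertex
   lowers f by at most 1, and only if the vertex lies in a counted component;
   inserting one lowers f by at most N, and only if it is adjacent to a counted
   component.  Hence the sum V of the squared losses of f under the flips of
   single coordinates, weighted by their probabilities, satisfies V <= a f.
   With the two-point inequality Ent(e^g) <= p (1 - p) / 2 (g1 - g0)^2 e^(max g)
   and tensorisation this gives Ent(e^(t f)) <= t^2 / 2 a E[f e^(t f)] for
   t >= 0, with an additional factor e^(c |t|) for t < 0, and Herbst's argument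
   yields bounds on E e^(t f).  These survive the limits of vanishing mesh and
   growing window; the one for t < 0 also excludes an infinite expectation. *)

(** * Entropy of a two-point distribution *)

(** Write [N = (4 d + 1) ^ d]. Points of two adjacent cells of mesh at most [rho / 2] differ by at
    most [2 rho] in every coordinate, and a grid of side [rho / d] cuts a cube of half-width [2 rho]
    into at most [N] pieces of Euclidean diameter at most [rho]. This one count yields both
    geometric inputs: a cell has at most [N] pairwise non-adjacent neighbours, and its neighbours
    have total mass at most [N sigma]. The loss estimate then has the factor [k (N^3 sigma + 1)],
    and [c_d = N^2] is chosen because [N^3 <= c_d^2]; it also bounds the jumps of [f].

    The obstacle is that [f] is not monotone: a new point may create, merge or destroy components,
    so the losses under both kinds of flip must be controlled. Moreover the mesh that resolves a
    realisation depends on the realisation, so every exponential bound has to be uniform in the mesh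
    before a limit is taken. *)

Section two_point_entropy.
Context {R : realType}.
Implicit Types p x y u v : R.

Definition xlnx x := x * ln x.

Definition ent2 p x y :=
  (1 - p) * xlnx x + p * xlnx y - xlnx ((1 - p) * x + p * y).

Lemma mean2_gt0 p x y : 0 <= p <= 1 -> 0 < x -> 0 < y ->
  0 < (1 - p) * x + p * y.
Proof.
move=> /andP[p0 p1] x0 y0; have [->|pn0] := eqVneq p 0; first by lra.
have pgt0 : 0 < p by rewrite lt_def pn0.
have : 0 < p * y by rewrite mulr_gt0.
have : 0 <= (1 - p) * x by rewrite mulr_ge0 ?subr_ge0 // ltW.
lra.
Qed.

(** Fenchel-Young for the conjugate pair [x ln x - x] and [expR], scaled by [m]; it amounts to
    [1 + v <= expR v] at [v = u + ln m - ln x]. *)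
Lemma young_xlnx x m u : 0 < x -> 0 < m ->
  x * u <= x * (ln x - ln m) + m * expR u - x.
Proof.
move=> x0 m0; set v := u + ln m - ln x.
have ev : expR v = m * expR u / x.
  by rewrite /v expRB expRD !lnK ?posrE //; field; rewrite gt_eqF.
have /(ler_wpM2l (ltW x0)) := expR_ge1Dx v.
rewrite ev.
have -> : x * (m * expR u / x) = m * expR u by field; rewrite gt_eqF.
rewrite /v; nra.
Qed.

(** One half of Gibbs' variational formula. Young's inequality at the mean [m] is averaged over the
    two points; the terms [- x] and [- y] average to [- m], which absorbs [m] times the mean of the
    exponentials. *)
Lemma ent2_ge p x y u v : 0 <= p <= 1 -> 0 < x -> 0 < y ->
  (1 - p) * expR u + p * expR v <= 1 ->
  (1 - p) * (x * u) + p * (y * v) <= ent2 p x y.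
Proof.
move=> p01 x0 y0 euv; have /andP[p0 p1] := p01.
have m0 := mean2_gt0 p01 x0 y0; rewrite /ent2 /xlnx.
set m := _ + p * y in m0 *.
have q0 : 0 <= 1 - p by lra.
have := ler_wpM2l q0 (young_xlnx u x0 m0).
have := ler_wpM2l p0 (young_xlnx v y0 m0).
have := ler_wpM2l (ltW m0) euv.
have mE : m = (1 - p) * x + p * y by [].
have : m * ln m = (1 - p) * x * ln m + p * y * ln m by rewrite {1}mE; ring.
lra.
Qed.

(** By Gibbs' formula the entropy is a supremum of linear functionals, hence convex: the pair
    [(u, v)] that attains it at the mixture is a competitor at both ends. This is what later moves a
    conditional entropy inside an average. *)
Lemma ent2_convex p q x y x' y' : 0 <= p <= 1 -> 0 <= q <= 1 ->
  0 < x -> 0 < y -> 0 < x' -> 0 < y' ->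
  ent2 p ((1 - q) * x + q * x') ((1 - q) * y + q * y') <=
  (1 - q) * ent2 p x y + q * ent2 p x' y'.
Proof.
move=> p01 q01 x0 y0 x'0 y'0.
have /andP[q0 q1] := q01.
have X0 := mean2_gt0 q01 x0 x'0; have Y0 := mean2_gt0 q01 y0 y'0.
set X := _ + q * x' in X0 *; set Y := _ + q * y' in Y0 *.
have m0 := mean2_gt0 p01 X0 Y0; set m := _ + p * Y in m0.
have mE : m = (1 - p) * X + p * Y by [].
pose u := ln X - ln m; pose v := ln Y - ln m.
have euv : (1 - p) * expR u + p * expR v <= 1.
  rewrite /u /v !expRB !lnK ?posrE //.
  have -> : (1 - p) * (X / m) + p * (Y / m) = 1 by
    rewrite !mulrA -mulrDl -mE divff // gt_eqF.
  by [].
have -> : ent2 p X Y = (1 - p) * (X * u) + p * (Y * v).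
  by rewrite /ent2 /xlnx -mE /u /v {1}mE; ring.
have H1 : 0 <= 1 - q by lra.
have := ler_wpM2l H1 (ent2_ge p01 x0 y0 euv).
have := ler_wpM2l q0 (ent2_ge p01 x'0 y'0 euv).
rewrite /X /Y; lra.
Qed.

(** This bound and the next serve the larger and the smaller of the two values in the two-point
    inequality; in both, the difference of the sides vanishes at [0] and has a nonnegative
    derivative. *)
Lemma expRN_le_quad x : 0 <= x -> expR (- x) <= 1 - x + x ^+ 2 / 2.
Proof.
move=> x0.
pose h : R -> R := cst 1 - id + 2^-1 *: (id ^+ 2) - (expR \o -%R).
have dh y : is_derive y 1 h (- 1 + y + expR (- y)).
  by apply: is_derive_eq; rewrite /GRing.scale /=; field.
suff : h 0 <= h x by rewrite /h !fctE /= /GRing.scale /= oppr0 expR0; lra.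
apply: (@ger0_derive1_ndecry _ h 0) => // [y _|].
- rewrite derive1E; case: (dh y) => _ ->.
  by have := expR_ge1Dx (- y); lra.
- apply: continuous_subspaceT => y; apply/differentiable_continuous/derivable1_diffP.
  by case: (dh y).
Qed.

Lemma expRN_ge_quad x : 0 <= x -> 1 - x ^+ 2 / 2 <= (1 + x) * expR (- x).
Proof.
move=> x0.
pose h : R -> R := (cst 1 + id) * (expR \o -%R) + 2^-1 *: (id ^+ 2).
have dh y : is_derive y 1 h (y * (1 - expR (- y))).
  by apply: is_derive_eq; rewrite /GRing.scale /= !fctE /=; field.
suff : h 0 <= h x by rewrite /h !fctE /= /GRing.scale /= oppr0 expR0; lra.
apply: (@ger0_derive1_ndecry _ h 0) => // [y|].
- rewrite in_itv /= andbT => y0; rewrite derive1E; case: (dh y) => _ ->.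
  by rewrite mulr_ge0 ?(ltW y0) // subr_ge0 -[leRHS]expR0 ler_expR oppr_le0 ltW.
- apply: continuous_subspaceT => y; apply/differentiable_continuous/derivable1_diffP.
  by case: (dh y).
Qed.

(* Gibbs' variational bound at the geometric mean of the two values. *)
Lemma ent2_expR_le p x u : 0 <= p <= 1 -> 0 <= u ->
  ent2 p (expR x) (expR (x - u)) <= p * (1 - p) / 2 * u ^+ 2 * expR x.
Proof.
move=> p01 u0; have /andP[p0 p1] := p01.
set X := expR x; set E := expR (- u).
have X0 : 0 < X by exact: expR_gt0.
have -> : expR (x - u) = X * E by rewrite expRD.
have E0 : 0 < E by exact: expR_gt0.
pose m := (1 - p) * X + p * (X * E).
have m0 : 0 < m by apply: mean2_gt0 => //; rewrite mulr_gt0.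
have /= Y := @young_xlnx m (X * expR (- (p * u))) 0 m0 (mulr_gt0 X0 (expR_gt0
  _)).
rewrite expR0 mulr1 mulr0 lnM ?posrE ?expR_gt0 // expRK in Y.
rewrite /ent2 /xlnx lnM ?posrE // !expRK -/m.
have q0 : 0 <= 1 - p by lra.
have B1 := expRN_le_quad (mulr_ge0 p0 u0).
have B2 := expRN_ge_quad (mulr_ge0 q0 u0).
set F := expR (- (p * u)) in Y B1.
have EF : E = F * expR (- ((1 - p) * u)).
  by rewrite /E /F -expRD; congr expR; ring.
have F0 : 0 < F by exact: expR_gt0.
have F1 : F <= 1 by rewrite /F -expR0 ler_expR; nra.
set G := expR _ in B2 EF.
(* Divided by [X], the entropy is at most the sum of the left sides of [K1] and [K2]. The right
   sides add up to the claim, as [(1 - p) p^2 + p (1 - p)^2 = p (1 - p)]. *)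
have K1 : (1 - p) * (p * u - 1 + F) <= (1 - p) * ((p * u) ^+ 2 / 2).
  by apply: ler_wpM2l => //; lra.
have K2 : p * (F * (1 - (1 + (1 - p) * u) * G)) <= p * (((1 - p) * u) ^+ 2 / 2).
  apply: ler_wpM2l => //.
  have B3 : 0 <= ((1 - p) * u) ^+ 2 / 2 by rewrite divr_ge0 ?sqr_ge0.
  apply: (@le_trans _ _ (F * (((1 - p) * u) ^+ 2 / 2)));
    first by apply: ler_wpM2l; lra.
  by rewrite ler_piMl.
have := ler_wpM2l (ltW X0) (lerD K1 K2).
move: Y; rewrite expRK; move: (ln m) => L; rewrite /m EF; lra.
Qed.

End two_point_entropy.

(** * Entropy in Bernoulli products *)

Section set_updates.
Context {I : finType}.
Implicit Types (i j : I) (S : {set I}).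
Local Open Scope set_scope.

Lemma setD1_idem i S : (S :\ i) :\ i = S :\ i.
Proof. by apply/finset.setP=> x; rewrite !inE; case: eqP. Qed.

Lemma setU1_idem i S : i |: (i |: S) = i |: S.
Proof. by rewrite finset.setUA finset.setUid. Qed.

Lemma setU1_setD1 i S : i |: (S :\ i) = i |: S.
Proof. by apply/finset.setP=> x; rewrite !inE; case: eqP. Qed.

Lemma setD1_setU1 i S : (i |: S) :\ i = S :\ i.
Proof. by apply/finset.setP=> x; rewrite !inE; case: eqP. Qed.

Lemma setD1_notin i S : i \notin S -> S :\ i = S.
Proof.
move=> iS; apply/finset.setP=> x; rewrite !inE.
by case: eqP => // ->; rewrite (negPf iS).
Qed.

Lemma setD1C i j S : (S :\ i) :\ j = (S :\ j) :\ i.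
Proof. by apply/finset.setP => x; rewrite !inE andbCA. Qed.

Lemma setU1_setD1C i j S : i != j -> i |: (S :\ j) = (i |: S) :\ j.
Proof.
move=> ij; apply/finset.setP => x; rewrite !inE.
by have [->|] := eqVneq x i; rewrite ?ij ?orbT ?orbF.
Qed.

End set_updates.

Section bernoulli_product.
Import mathcomp.boot.finset.
Context {R : realType} {I : finType}.
Variable p : I -> R.
Hypothesis p01 : forall i, 0 <= p i <= 1.
Implicit Types (f g h : {set I} -> R) (S : {set I}) (s : seq I).
Local Open Scope set_scope.
Local Open Scope ring_scope.

Definition bern_wt S : R := \prod_i (if i \in S then p i else 1 - p i).

Definition bern_mean g : R := \sum_(S : {set I}) bern_wt S * g S.

(** Conditional expectation given the coordinates other than [i], kept as a function of the whole
    set. *)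
Definition resample i g S := (1 - p i) * g (S :\ i) + p i * g (i |: S).

Definition resamples s g := foldr resample g s.

Let p0 i : 0 <= p i. Proof. by case/andP: (p01 i). Qed.
Let q0 i : 0 <= 1 - p i. Proof. by rewrite subr_ge0; case/andP: (p01 i). Qed.

Lemma bern_wt_ge0 S : 0 <= bern_wt S.
Proof. by apply: prodr_ge0 => i _; case: ifP. Qed.

Lemma sum_bern_wt : \sum_(S : {set I}) bern_wt S = 1.
Proof.
have <- : \prod_i (p i + (1 - p i)) = 1 by apply: big1 => i _;
  rewrite addrC subrK.
by rewrite bigA_distr.
Qed.

Lemma bern_mean_cst (c : R) : bern_mean (fun=> c) = c.
Proof. by rewrite /bern_mean -mulr_suml sum_bern_wt mul1r. Qed.

Lemma ler_bern_mean g h : (forall S, g S <= h S) -> bern_mean g <= bern_mean h.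
Proof. by move=> gh; apply: ler_sum => S _; rewrite ler_wpM2l ?bern_wt_ge0. Qed.

Lemma bern_meanZ (c : R) g : bern_mean (fun S => c * g S) = c * bern_mean g.
Proof. by rewrite /bern_mean mulr_sumr; apply: eq_bigr => S _;
  rewrite mulrCA. Qed.

Lemma bern_mean_sum (J : finType) (g : J -> {set I} -> R) :
  bern_mean (fun S => \sum_j g j S) = \sum_j bern_mean (g j).
Proof.
by rewrite /bern_mean exchange_big; apply: eq_bigr => S _; rewrite mulr_sumr.
Qed.

Lemma bern_mean_gt0 g : (forall S, 0 < g S) -> 0 < bern_mean g.
Proof.
move=> g0; rewrite lt_def sumr_ge0 ?andbT => [|S _]; last first.
  by rewrite mulr_ge0 ?bern_wt_ge0 // ltW.
apply/eqP => /psumr_eq0P E0.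
have : \sum_(S : {set I}) bern_wt S = 0.
  apply: big1 => S _.
  have /eqP : bern_wt S * g S = 0.
    by apply: E0 => // S' _; rewrite mulr_ge0 ?bern_wt_ge0 // ltW.
  by rewrite mulf_eq0 (gt_eqF (g0 S)) orbF => /eqP.
by rewrite sum_bern_wt => /eqP; rewrite oner_eq0.
Qed.

Let flip i S := if i \in S then S :\ i else i |: S.

Let flipK i : involutive (flip i).
Proof.
move=> S; rewrite /flip; case: (boolP (i \in S)) => iS; rewrite !inE eqxx /=.
  by rewrite setD1K.
by rewrite setU1K.
Qed.

(** Flipping coordinate [i] pairs up the subsets. Twice the mean is a sum over such pairs, and
    within a pair the weight of the other coordinates factors out. *)
Lemma bern_mean_resample i g : bern_mean (resample i g) = bern_mean g.
Proof.
have E h : 2 * bern_mean h =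
    \sum_(S : {set I}) (bern_wt S * h S + bern_wt (flip i S) * h (flip i S)).
  rewrite big_split /= mulr_natl mulr2n; congr (_ + _).
  by rewrite [LHS](reindex_inj (inv_inj (flipK i))).
apply: (@mulfI _ 2); first by rewrite pnatr_eq0.
rewrite !E; apply: eq_bigr => S _.
have W S' : bern_wt S' = (if i \in S' then p i else 1 - p i) *
    \prod_(j | j != i) (if j \in S' then p j else 1 - p j) by rewrite /bern_wt
      (bigD1 i).
rewrite !W.
have -> : \prod_(j | j != i) (if j \in flip i S then p j else 1 - p j) =
          \prod_(j | j != i) (if j \in S then p j else 1 - p j).
  apply: eq_bigr => j ji; rewrite /flip.
  by case: (i \in S); rewrite !inE (negPf ji) ?andTb ?orFb.
set w := \prod_(j | j != i) _; rewrite /resample /flip.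
case: (boolP (i \in S)) => iS; rewrite !inE ?eqxx ?(negPf iS) /=.
  by rewrite !setD1K // (setUidPr _) ?sub1set // setD1_idem; ring.
by rewrite setU1K // setU1_idem setD1_notin //; ring.
Qed.

Lemma bern_mean_resamples s g : bern_mean (resamples s g) = bern_mean g.
Proof. by elim: s => //= i s IH; rewrite bern_mean_resample. Qed.

Lemma resamples_local s g S S' :
  (forall j, j \notin s -> (j \in S) = (j \in S')) ->
  resamples s g S = resamples s g S'.
Proof.
elim: s S S' => [|i s IH] S S' SS' /=.
  by congr g; apply/setP => j; apply: SS'.
by congr (_ * _ + _ * _); apply: IH => j js; rewrite !inE;
  have [//|/= ji] := eqVneq j i; apply: SS'; rewrite inE negb_or ji.
Qed.

(** With every coordinate integrated out nothing depends on [S] any more, so the value equals its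
    own mean, which resampling preserves. *)
Lemma resamplesE g S : resamples (enum I) g S = bern_mean g.
Proof.
rewrite -(bern_mean_resamples (enum I)) -[LHS]bern_mean_cst.
by apply: eq_bigr => S' _; congr (_ * _); apply: resamples_local => j;
  rewrite mem_enum.
Qed.

Lemma ler_resample i g h S : (forall S, g S <= h S) ->
  resample i g S <= resample i h S.
Proof. by move=> gh; apply: lerD; apply: ler_wpM2l. Qed.

Lemma resample_gt0 i g S : (forall S, 0 < g S) -> 0 < resample i g S.
Proof. by move=> g0; apply: mean2_gt0. Qed.

Lemma resamples_gt0 s g S : (forall S, 0 < g S) -> 0 < resamples s g S.
Proof. by move=> g0; elim: s S => //= i s IH S; apply: resample_gt0. Qed.

Lemma resample_sum i (J : Type) (r : seq J) (g : J -> {set I} -> R) S :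
  resample i (fun S => \sum_(j <- r) g j S) S = \sum_(j <- r) resample i (g j)
    S.
Proof. by rewrite /resample !mulr_sumr -big_split. Qed.

Lemma resampleC i j g : resample i (resample j g) = resample j (resample i g).
Proof.
have [->//|ij] := eqVneq i j; have ji : j != i by rewrite eq_sym.
apply/funext => S; rewrite /resample (setD1C i j) -!setU1_setD1C //.
by rewrite (setUCA [set j]); ring.
Qed.

Definition ent_at i g S := ent2 (p i) (g (S :\ i)) (g (i |: S)).

Lemma resample_ent_at i g : resample i (ent_at i g) = ent_at i g.
Proof.
apply/funext => S; rewrite /resample /ent_at.
by rewrite setD1_idem setU1_idem setU1_setD1 setD1_setU1; ring.
Qed.

Lemma ent_at_resample i j g S : i != j -> (forall S, 0 < g S) ->
  ent_at i (resample j g) S <= resample j (ent_at i g) S.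
Proof.
move=> ij g0; have ji : j != i by rewrite eq_sym.
rewrite /resample /ent_at (setD1C i j) -!setU1_setD1C // (setUCA [set j]).
exact: ent2_convex.
Qed.

Lemma ent_at_resamples i s g S : i \notin s -> (forall S, 0 < g S) ->
  ent_at i (resamples s g) S <= resamples s (ent_at i g) S.
Proof.
move=> + g0; elim: s S => //= j s IH S; rewrite inE negb_or => /andP[ij js].
apply: le_trans (ent_at_resample _ ij _) _ => [S'|]; first exact: resamples_gt0.
by apply: ler_resample => S'; apply: IH.
Qed.

Lemma resample_resamples i s g : resample i (resamples s g) = resamples s
  (resample i g).
Proof. by elim: s => //= j s <-; rewrite resampleC. Qed.

(** Tensorisation, one coordinate at a time. With [h = resamples s g], the entropy over [i :: s] is
    the [i]-average of the entropy over [s] plus the entropy of [h] in coordinate [i]; convexity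
    bounds the latter by the [s]-average of the entropy of [g] in coordinate [i]. *)
Lemma ent_resamples_le s g S : uniq s -> (forall S, 0 < g S) ->
  resamples s (xlnx \o g) S - xlnx (resamples s g S) <=
  \sum_(i <- s) resamples s (ent_at i g) S.
Proof.
move=> + g0; elim: s S => [|i s IH] S /=; first by rewrite subrr big_nil.
move=> /andP[si us].
have step : resample i (resamples s (xlnx \o g)) S <=
    resample i (fun S => xlnx (resamples s g S) + \sum_(j <- s) resamples s
      (ent_at j g) S) S.
  by apply: ler_resample => S'; rewrite -lerBlDl; apply: IH.
have -> : \sum_(j <- i :: s) resample i (resamples s (ent_at j g)) S =
    resamples s (ent_at i g) S + \sum_(j <- s) resample i (resamples s (ent_at
      j g)) S.
  by rewrite big_cons resample_resamples resample_ent_at.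
have E := ent_at_resamples S si g0.
rewrite -resample_sum.
move: step E; rewrite /ent_at /ent2 /resample; lra.
Qed.

Lemma ent_mean_le g : (forall S, 0 < g S) ->
  bern_mean (xlnx \o g) - xlnx (bern_mean g) <= \sum_i bern_mean (ent_at i g).
Proof.
move=> g0; have := ent_resamples_le finset.set0 (enum_uniq I) g0.
by rewrite !resamplesE big_enum; under eq_bigr do rewrite resamplesE.
Qed.

End bernoulli_product.

(** * Herbst's argument *)

Section herbst.
Context {R : realType} {I : finType}.
Variable p : I -> R.
Hypothesis p01 : forall i, 0 <= p i <= 1.
Implicit Types (f g : {set I} -> R) (S : {set I}) (a c s t : R).
Local Open Scope set_scope.
Local Open Scope ring_scope.

Local Notation E := (bern_mean p).

(* The squared loss of [f] when coordinate [i] of [S] is flipped, weighted by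
   the probability that an independent copy of the coordinate is flipped. *)
Definition vplus_at f i S : R :=
  if i \in S then (1 - p i) * Num.max 0 (f S - f (S :\ i)) ^+ 2
  else p i * Num.max 0 (f S - f (i |: S)) ^+ 2.

Definition vplus f S : R := \sum_i vplus_at f i S.

Lemma ent2C q x y : ent2 q x y = ent2 (1 - q) y x :> R.
Proof.
rewrite /ent2.
have -> : 1 - (1 - q) = q by ring.
by rewrite [_ * y + _]addrC [_ * xlnx y + _]addrC.
Qed.

Lemma ent_at_expR_le f i S c t :
  `|f (i |: S) - f (S :\ i)| <= c ->
  ent_at p i (fun S => expR (t * f S)) S <=
  t ^+ 2 / 2 * expR (c * Num.max 0 (- t)) *
  resample p i (fun S => expR (t * f S) * vplus_at f i S) S.
Proof.
move=> fc; rewrite /ent_at /resample /vplus_at.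
rewrite setD1_idem setU1_idem setU1_setD1 setD1_setU1 !inE eqxx /=.
have /andP[p0 p1] := p01 i; have q01 : 0 <= 1 - p i <= 1 by lra.
move: (f (S :\ i)) (f (i |: S)) fc => x y fc.
set B := expR (c * _).
have c0 : 0 <= c by rewrite (le_trans _ fc).
have H (q u v : R) : 0 <= q <= 1 -> `|v - u| <= c -> u <= v ->
    ent2 q (expR (t * u)) (expR (t * v)) <=
    t ^+ 2 / 2 * B * (q * (1 - q) * (v - u) ^+ 2 * expR (t * v)).
  move=> q01' uvc uv; have /andP[q0 q1] := q01'.
  have uvc' : v - u <= c by rewrite (le_trans (ler_norm _)).
  have K : 0 <= q * (1 - q) / 2 * (t * (v - u)) ^+ 2.
    by rewrite mulr_ge0 ?sqr_ge0 // divr_ge0 // mulr_ge0 // subr_ge0.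
  have [t0|t0] := leP 0 t.
    have /= := @ent2_expR_le _ (1 - q) (t * v) (t * (v - u)).
    rewrite ent2C; have -> : 1 - (1 - q) = q by ring.
    have -> : t * v - t * (v - u) = t * u by ring.
    have q01'' : 0 <= 1 - q <= 1 by lra.
    move=> /(_ q01'') /(_ _) /le_trans; apply;
      first by rewrite mulr_ge0 ?subr_ge0.
    have -> : B = 1 by rewrite /B max_l ?mulr0 ?expR0 // oppr_le0.
    by rewrite le_eqVlt; apply/orP; left; apply/eqP; field.
  have /= := @ent2_expR_le _ q (t * u) (- t * (v - u)) q01'.
  have -> : t * u - (- t * (v - u)) = t * v by ring.
  move=> /(_ _) /le_trans; apply; first by rewrite mulr_ge0 ?subr_ge0 //
    oppr_ge0 ltW.
  have BE : expR (t * u) <= B * expR (t * v).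
    rewrite /B max_r ?oppr_ge0 ?(ltW t0) // -expRD ler_expR; nra.
  have := ler_wpM2l K BE; lra.
have [xy|yx] := leP x y.
  have := H _ _ _ (p01 i) fc xy => /le_trans; apply.
  rewrite (@max_l _ _ 0 (x - y)) ?subr_le0 // (@max_r _ _ 0 (y - x)) ?subr_ge0
    //.
  by rewrite le_eqVlt; apply/orP; left; apply/eqP; ring.
have := H _ y x q01; rewrite distrC => /(_ fc (ltW yx));
  rewrite -ent2C => /le_trans; apply.
rewrite (@max_r _ _ 0 (x - y)) ?subr_ge0 ?(ltW yx) // (@max_l _ _ 0 (y - x))
  ?subr_le0 ?(ltW yx) //.
by rewrite le_eqVlt; apply/orP; left; apply/eqP; ring.
Qed.

Lemma ent_expR_le f a c t :
  (forall S, vplus f S <= a * f S) ->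
  (forall i S, `|f (i |: S) - f (S :\ i)| <= c) ->
  t * E (fun S => f S * expR (t * f S)) - xlnx (E (fun S => expR (t * f S))) <=
  t ^+ 2 / 2 * expR (c * Num.max 0 (- t)) * (a * E (fun S =>
    f S * expR (t * f S))).
Proof.
move=> va fc.
have g0 S : 0 < expR (t * f S) by exact: expR_gt0.
have := ent_mean_le p01 g0.
have -> : E (xlnx \o (fun S => expR (t * f S))) = t * E (fun S =>
  f S * expR (t * f S)).
  by rewrite -bern_meanZ; apply: eq_bigr => S _ /=; rewrite /xlnx expRK; ring.
move=> /le_trans; apply.
set K := t ^+ 2 / 2 * _.
have K0 : 0 <= K by rewrite mulr_ge0 ?expR_ge0 // divr_ge0 // sqr_ge0.
apply: (@le_trans _ _ (K * E (fun S => expR (t * f S) * vplus f S))).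
  apply: (@le_trans _ _ (\sum_i K * E (fun S =>
    expR (t * f S) * vplus_at f i S))).
    apply: ler_sum => i _.
    rewrite -[in leRHS](bern_mean_resample p i) -bern_meanZ.
    by apply: ler_bern_mean => // S; apply: ent_at_expR_le.
  rewrite -mulr_sumr -bern_mean_sum le_eqVlt; apply/orP; left; apply/eqP.
  by congr (K * _); apply: eq_bigr => S _; rewrite /vplus !mulr_sumr.
apply: ler_wpM2l => //; rewrite -bern_meanZ; apply: ler_bern_mean => // S.
rewrite mulrC [leRHS](_ : _ = a * f S * expR (t * f S)); last by ring.
by rewrite ler_wpM2r // expR_ge0.
Qed.

End herbst.

Lemma is_derive_bigsum (R : realType) (J : Type) (r : seq J) (h : J -> R -> R)
    (dh : J -> R) (x : R) :
  (forall j, is_derive x 1 (h j) (dh j)) ->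
  is_derive x 1 (fun y => \sum_(j <- r) h j y) (\sum_(j <- r) dh j).
Proof.
move=> H; elim: r => [|j r IH].
  rewrite big_nil (_ : (fun _ => _) = cst 0); first exact: is_derive_cst.
  by apply/funext => y; rewrite big_nil.
rewrite big_cons (_ : (fun _ => _) = h j + (fun y => \sum_(j <- r) h j y));
  first exact: is_deriveD.
by apply/funext => y; rewrite big_cons.
Qed.

Section log_laplace.
Context {R : realType} {I : finType}.
Variable p : I -> R.
Hypothesis p01 : forall i, 0 <= p i <= 1.
Implicit Types (f g : {set I} -> R) (a c s t : R).
Local Notation E := (bern_mean p).

Lemma is_derive_laplace g t :
  is_derive t 1 (fun s => E (fun S => expR (s * g S))) (E (fun S =>
    g S * expR (t * g S))).
Proof.
apply: is_derive_bigsum => S.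
have H : is_derive t 1 (bern_wt p S *: (expR \o (g S *: id)) : R ->
  R) (bern_wt p S * (g S * expR (t * g S))).
  apply: is_derive_eq; rewrite /GRing.scale /=.
  by rewrite (_ : g S *: t = t * g S); [ring|exact: mulrC].
rewrite (_ : (fun _ => _) = (bern_wt p S *: (expR \o (g S *: id)) : R -> R)) //.
by apply/funext => y; rewrite /= [y * _]mulrC.
Qed.

(* The hypothesis makes [ln (E (expR (s * g))) / L s] nonincreasing in [s]; as
   [s] tends to [0] it tends to [E g]. *)
Lemma herbst g (L dL : R -> R) t : 0 < t ->
  (forall s, 0 < s -> s <= t -> is_derive s 1 L (dL s)) ->
  (forall s, 0 < s -> s <= t -> 0 < L s) ->
  (fun s => s / L s) @ 0^'+ --> (1 : R) ->
  (forall s, 0 < s -> s <= t -> L s * E (fun S => g S * expR (s * g S)) <=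
     dL s * xlnx (E (fun S => expR (s * g S)))) ->
  ln (E (fun S => expR (t * g S))) <= L t * E g.
Proof.
move=> t0 L' L0 L1 LE.
pose M s := E (fun S => expR (s * g S)).
have M0 s : 0 < M s by apply: bern_mean_gt0 => // S; exact: expR_gt0.
have dM s : is_derive s 1 M (E (fun S => g S * expR (s * g S))) :=
  is_derive_laplace g s.
pose q : R -> R := (@ln R \o M) * (fun s => (L s)^-1).
have dq s : 0 < s -> s <= t -> is_derive s 1 q
    ((E (fun S => g S * expR (s * g S)) / M s) / L s - ln (M s) * dL s / L s ^+
      2).
  move=> s0 st; have Ls := L0 _ s0 st; have dLs := L' _ s0 st.
  have dln : is_derive s 1 (@ln R \o M) ((M s)^-1 * E (fun S =>
    g S * expR (s * g S))).
    by apply: is_derive1_comp; apply: is_derive1_ln.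
  have dinv : is_derive s 1 (fun s => (L s)^-1) (- (L s) ^- 2 *: dL s).
    apply: is_deriveV; rewrite ?gt_eqF //.
  apply: is_derive_eq; rewrite /GRing.scale /=; field.
  by rewrite !gt_eqF.
have qle e : 0 < e -> e <= t -> q t <= q e.
  move=> e0 et.
  have cq s : s \in `[e, t] -> {for s, continuous q}.
    rewrite in_itv /= => /andP[es st].
    have H := dq s (lt_le_trans e0 es) st.
    by apply/differentiable_continuous/derivable1_diffP; case: H.
  apply: (@ler0_derive1_le_cc _ q e t); rewrite ?in_itv /= ?lexx ?et //.
  - move=> s; rewrite in_itv /= => /andP[es st].
    by case: (dq s (lt_trans e0 es) (ltW st)).
  - move=> s; rewrite in_itv /= => /andP[es st].
    have s0 := lt_trans e0 es; have Ls := L0 _ s0 (ltW st).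
    rewrite derive1E; case: (dq s s0 (ltW st)) => _ ->.
    have := LE _ s0 (ltW st); rewrite /xlnx -/(M s).
    set D := E _ => H.
    have -> : D / M s / L s - ln (M s) * dL s / L s ^+ 2 =
        (L s * D - dL s * (M s * ln (M s))) / (M s * L s ^+ 2).
      by field; rewrite !gt_eqF.
    by rewrite pmulr_lle0 ?subr_le0 // invr_gt0 mulr_gt0 // exprn_gt0.
  - by apply: continuous_in_subspaceT => s /set_mem /=; exact: cq.
(* Only an upper bound on [q] near [0] is needed, so [ln (M e)] may be replaced by [M e - 1], whose
   limit is the derivative of [M] at [0]. *)
have q_lim : (fun e => (M e - 1) / L e) @ 0^'+ --> E g.
  have <- : 'D_1 M 0 = E g.
    by rewrite derive_val; apply: eq_bigr => S _; rewrite mul0r expR0 mulr1.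
  have M1 : M 0 = 1.
    rewrite -[RHS](bern_mean_cst p).
    by apply: eq_bigr => S _; rewrite mul0r expR0.
  have H : (fun e => (M e - 1) / e) @ 0^'+ --> 'D_1 M 0.
    apply: cvg_dnbhs_at_right; have [dM0 _] := dM 0; move: dM0.
    rewrite /derivable -/(derive M 0 1); apply: cvg_trans.
    apply: near_eq_cvg; near=> e.
    by rewrite /= -/(M 0) M1 [_%:A]mulr1 addr0 [LHS]mulrC.
  rewrite -[X in _ --> X]mulr1.
  apply: cvg_trans (cvgM H L1); apply: near_eq_cvg; near=> e.
  have e0 : 0 < e by near: e; exact: nbhs_right_gt.
  have e1 : e <= t by near: e; exact: nbhs_right_le.
  by rewrite /=; field; rewrite !gt_eqF // L0.
have H : q t <= E g.
  apply: (cvgr_to_ge q_lim); near=> e.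
  have e0 : 0 < e by near: e; exact: nbhs_right_gt.
  have e1 : e <= t by near: e; exact: nbhs_right_le.
  apply: le_trans (qle _ e0 e1) _.
  rewrite /q /GRing.mul /= ler_wpM2r ?invr_ge0 ?(ltW (L0 _ _ _)) //.
  by rewrite -[X in ln X](subrK 1) addrC le_ln1Dx // ltrBrDr addNr.
move: H; rewrite /q /= /GRing.mul /= -/(M t).
by rewrite ler_pdivrMr ?L0 // mulrC.
Unshelve. all: by end_near. Qed.

(** The entropy bound reads [s (1 - a s / 2) M' <= M ln M] for the Laplace transform [M]. The
    function [L] is the solution of [L' / L = 1 / (s (1 - a s / 2))] with [L s / s] tending to [1];
    its pole gives the condition [a * t < 2]. *)
Lemma log_laplace_upper f a c t :
  (forall S, vplus p f S <= a * f S) ->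
  (forall i S, `|f (i |: S)%SET - f (S :\ i)%SET| <= c) ->
  0 <= a -> 0 < t -> a * t < 2 ->
  ln (E (fun S => expR (t * f S))) <= t / (1 - a * t / 2) * E f.
Proof.
move=> va fc a0 t0 at2.
have den s : 0 < s -> s <= t -> 0 < 1 - a * s / 2.
  by move=> s0 st; have := ler_wpM2l a0 st; lra.
apply: (@herbst f (fun s => s / (1 - a * s / 2)) (fun s =>
  (1 - a * s / 2) ^- 2)) => //.
- move=> s s0 st; have d0 := den _ s0 st.
  pose k : R -> R := cst 1 - (a / 2) *: id.
  have ks x : 1 - a * x / 2 = k x by rewrite /k !fctE /= /GRing.scale /=; ring.
  have -> : (fun s => s / (1 - a * s / 2)) = id * (fun x => (k x)^-1).
    by apply/funext => x; rewrite ks.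
  rewrite ks in d0 *.
  have dk : is_derive s 1 k (- (a / 2)).
    by apply: is_derive_eq; rewrite /GRing.scale /= sub0r mulr1.
  have dki : is_derive s 1 (fun x => (k x)^-1) (- (k s) ^- 2 *: (- (a / 2))).
    by apply: is_deriveV; rewrite ?gt_eqF.
  apply: is_derive_eq; rewrite /GRing.scale /=.
  have ksE : k s = 1 - a * s / 2 by rewrite ks.
  rewrite ksE in d0 *; field; rewrite gt_eqF //; lra.
- by move=> s s0 st; rewrite divr_gt0 // den.
- apply: (@cvg_trans _ ((fun s => 1 - a * s / 2) @ 0^'+)).
    apply: near_eq_cvg; near=> s.
    have s0 : 0 < s by near: s; exact: nbhs_right_gt.
    have st : s <= t by near: s; exact: nbhs_right_le.
    have := den _ s0 st => d0.
    by field; rewrite !gt_eqF // ; lra.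
  apply: cvg_at_right_filter.
  rewrite [X in _ --> X](_ : 1 = 1 - a * 0 / 2);
    last by rewrite mulr0 mul0r subr0.
  by apply: cvgB; [exact: cvg_cst|apply: cvgMr_tmp; apply: cvgMl_tmp;
    exact: cvg_id].
- move=> s s0 st; have d0 := den _ s0 st.
  have := ent_expR_le p01 s va fc.
  rewrite max_l ?oppr_le0 ?(ltW s0) // mulr0 expR0 mulr1.
  set D := E _ => H.
  rewrite -[leLHS](_ : (1 - a * s / 2) ^- 2 * (s * (1 - a * s / 2) * D) = _).
    rewrite ler_pM2l ?invr_gt0 ?exprn_gt0 //; lra.
  by field; rewrite gt_eqF //; lra.
Unshelve. all: by end_near. Qed.

(** Herbst's argument for [- f], with the polynomial [L s = s - A s^2 / 2]. The entropy bound is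
    multiplied by [1 - A s], the derivative of [L], which must be nonnegative; hence the range
    [A * t <= 1]. *)
Lemma log_laplace_lower f a c A t :
  (forall S, vplus p f S <= a * f S) ->
  (forall i S, `|f (i |: S)%SET - f (S :\ i)%SET| <= c) ->
  (forall S, 0 <= f S) ->
  0 <= a -> a <= A -> 0 <= c -> c <= A -> 0 < t -> A * t <= 1 ->
  ln (E (fun S => expR (- t * f S))) <= - (t - A * t ^+ 2 / 2) * E f.
Proof.
move=> va fc f0 a0 aA c0 cA t0 At1.
have A0 : 0 <= A by exact: le_trans aA.
have As s : s <= t -> A * s <= 1 by move=> st; have := ler_wpM2l A0 st; lra.
pose L : R -> R := id - (A / 2) *: (id ^+ 2).
have LE s : L s = s - A * s ^+ 2 / 2 by rewrite /L !fctE /= /GRing.scale /=;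
  ring.
have -> : - (t - A * t ^+ 2 / 2) * E f = L t * E (fun S => - f S).
  rewrite LE -[E (fun S => - f S)](_ : -1 * E f = _) ?mulrA ?mulrN1 //.
  by rewrite -bern_meanZ; apply: eq_bigr => S _; rewrite mulN1r.
have -> : E (fun S => expR (- t * f S)) = E (fun S => expR (t * - f S)).
  by apply: eq_bigr => S _; rewrite mulrN mulNr.
apply: (@herbst _ L (fun s => 1 - A * s)) => //.
- move=> s s0 st; apply: is_derive_eq; rewrite /GRing.scale /=.
  by field.
- move=> s s0 /As; rewrite LE; nra.
- apply: (@cvg_trans _ ((fun s => (1 - A * s / 2)^-1) @ 0^'+)).
    apply: near_eq_cvg; near=> s.
    have s0 : 0 < s by near: s; exact: nbhs_right_gt.
    have st : s <= t by near: s; exact: nbhs_right_le.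
    have := As _ st => d0.
    rewrite /= LE; field; rewrite !gt_eqF //; nra.
  apply: cvg_at_right_filter.
  rewrite [X in _ --> X](_ : 1 = (1 - A * 0 / 2)^-1);
    last by rewrite mulr0 mul0r subr0 invr1.
  apply: cvgV; first by rewrite mulr0 mul0r subr0 oner_eq0.
  by apply: cvgB; [exact: cvg_cst|apply: cvgMr_tmp; apply: cvgMl_tmp;
    exact: cvg_id].
- move=> s s0 st; have As1 := As _ st.
  have := ent_expR_le p01 (- s) va fc.
  rewrite opprK max_r ?(ltW s0) // sqrrN LE.
  have -> : E (fun S => expR (- s * f S)) = E (fun S => expR (s * - f S)).
    by apply: eq_bigr => S _; rewrite mulrN mulNr.
  have -> : E (fun S => - f S * expR (s * - f S)) = -1 * E (fun S =>
    f S * expR (- s * f S)).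
    rewrite -bern_meanZ; apply: eq_bigr => S _; congr (_ * _).
    by rewrite (_ : s * - f S = - s * f S); ring.
  set D := E _; set X := xlnx _ => H.
  have D0 : 0 <= D.
    rewrite -(bern_mean_cst p 0); apply: ler_bern_mean => // S.
    by rewrite mulr_ge0 ?expR_ge0.
  (* The factor [expR (c * s)], the price for the negative exponent, is absorbed
     by the derivative [1 - A * s] of [L] because [c <= A]. *)
  have e1 : (1 - A * s) * expR (c * s) <= 1.
    apply: (@le_trans _ _ (expR (- (A * s)) * expR (c * s))).
      by rewrite ler_wpM2r ?expR_ge0 // expR_ge1Dx.
    rewrite -expRD -expR0 ler_expR; nra.
  have d0 : 0 <= 1 - A * s by rewrite subr_ge0.
  have := ler_wpM2l d0 H.
  have aD : 0 <= s ^+ 2 / 2 * (a * D) 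
    by apply: mulr_ge0; [rewrite divr_ge0 ?sqr_ge0|exact: mulr_ge0].
  have := ler_wpM2l aD e1.
  have : s ^+ 2 / 2 * (a * D) <= s ^+ 2 / 2 * (A * D).
    by rewrite ler_wpM2l ?divr_ge0 ?sqr_ge0 // ler_wpM2r.
  lra.
Unshelve. all: by end_near. Qed.

End log_laplace.

(** * Components of finite graphs *)

Section components.
Context {T : Type}.
Implicit Types (V C D : set T) (E : T -> T -> Prop).

(** A path inside [C] that starts in [D] cannot leave [D], because no edge to another vertex of [V]
    does. *)
Lemma component_sub_of_meet V E C D x : component V E C -> component V E D ->
  C x -> D x -> C `<=` D.
Proof.
move=> [_ CV Ccon _] [_ _ _ Dcl] Cx Dx y Cy.
have [s [sp <-]] := Ccon _ _ Cx Cy.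
elim: s x Cx Dx sp => //= v s IH x Cx Dx /andP[/asboolP[Cv Exv] sp].
apply: IH => //; apply: contrapT => nDv.
exact: Dcl Dx (CV _ Cv) nDv Exv.
Qed.

Lemma component_eq_of_meet V E C D x : component V E C -> component V E D ->
  C x -> D x -> C = D.
Proof.
move=> cC cD Cx Dx; apply/seteqP.
by split; [exact: component_sub_of_meet cC cD Cx Dx|
  exact: component_sub_of_meet cD cC Dx Cx].
Qed.

Lemma component_sep V E C D x y : component V E C -> component V E D ->
  C <> D -> C x -> D y -> ~ E x y.
Proof.
move=> cC cD CD Cx Dy; have [_ _ _ cl] := cC; have [_ DV _ _] := cD.
apply: (cl _ _ Cx (DV _ Dy)) => Cy.
by apply: CD; exact: component_eq_of_meet cC cD Cy Dy.
Qed.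

Lemma component_setD V V' E C : C `<=` V' -> V' `<=` V -> component V E C ->
  component V' E C.
Proof.
move=> CV' V'V [C0 _ con cl]; split => // x y Cx V'y; apply: cl => //.
exact: V'V.
Qed.

Lemma component_setU V V' E C : V `<=` V' ->
  (forall x y, C x -> V' y -> ~ V y -> ~ E x y) -> component V E C ->
  component V' E C.
Proof.
move=> VV' sep [C0 CV con cl]; split => //; first exact: subset_trans VV'.
move=> x y Cx V'y nCy; have [Vy|nVy] := pselect (V y); first exact: cl.
exact: sep.
Qed.

End components.

(** * Component counts when a vertex is inserted or deleted *)

Section component_count.
Context {I : finType}.
Variables (E : rel I) (Q : {set I} -> Prop).
Implicit Types (S C : {set I}).

Definition comps S : {set {set I}} :=
  finset (fun C : {set I} => `[< component [set` S] E [set` C] /\ Q C >]).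

Lemma compsP S C : reflect (component [set` S] E [set` C] /\ Q C) (C \in comps
  S).
Proof. by rewrite inE; exact: asboolP. Qed.

Lemma comps_eq_of_meet S C D x : C \in comps S -> D \in comps S ->
  x \in C -> x \in D -> C = D.
Proof.
move=> /compsP[cC _] /compsP[cD _] Cx Dx.
have CD : [set` C] = [set` D] by exact: component_eq_of_meet cC cD Cx Dx.
by apply/finset.setP => y; move/seteqP: CD => [CD DC]; apply/idP/idP;
  [exact: CD|exact: DC].
Qed.

Lemma comps_sep S C D x y : C \in comps S -> D \in comps S ->
  C != D -> x \in C -> y \in D -> ~~ E x y.
Proof.
move=> CS DS CD xC yD; have /compsP[cC _] := CS; have /compsP[cD _] := DS.
apply/negP; apply: (component_sep cC cD) => // /seteqP[sCD sDC].
by move/eqP: CD; apply; apply/finset.setP => z; apply/idP/idP;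
  [exact: sCD|exact: sDC].
Qed.

Definition independent_set (J : {set I}) :=
  forall x y, x \in J -> y \in J -> x != y -> ~~ E x y.

(** One vertex is picked from each component; distinct components are disjoint and not joined by
    edges. This turns bounds on independent sets, available from geometry, into bounds on numbers of
    components. *)
Lemma comps_transversal S (A : {set {set I}}) (W : pred I) :
  A \subset comps S -> (forall C, C \in A -> exists2 x, x \in C & W x) ->
  exists J : {set I}, [/\ #|J| = #|A|, forall x, x \in J ->
    W x & independent_set J].
Proof.
move=> /fintype.subsetP AS AW.
have [->|/finset.set0Pn[C0 C0A]] := eqVneq A finset.set0.
  by exists finset.set0; rewrite !finset.cards0; split => // x; rewrite inE.
have [x0 _ _] := AW _ C0A.
pose r (C : {set I}) := if [pick x in C | W x] is Some x then x else x0.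
have rP C : C \in A -> (r C \in C) /\ W (r C).
  move=> CA; rewrite /r; case: pickP => [x /andP[]//|].
  by have [x xC Wx] := AW _ CA => /(_ x); rewrite xC Wx.
exists (finset.imset r (mem A)); split.
- apply: finset.card_in_imset => C D CA DA rCD.
  apply: (@comps_eq_of_meet S C D (r C)); rewrite ?AS //.
    by have [] := rP _ CA.
  by rewrite rCD; have [] := rP _ DA.
- by move=> x /finset.imsetP[C CA ->]; have [] := rP _ CA.
- move=> x y /finset.imsetP[C CA ->] /finset.imsetP[D DA ->] rCD.
  apply: (@comps_sep S C D); rewrite ?AS //.
  + by apply: contraNneq rCD => ->.
  + by have [] := rP _ CA.
  + by have [] := rP _ DA.
Qed.

(** A component that avoids [i] survives the deletion of [i], and at most one component contains
    [i]. *)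
Lemma card_comps_rem S i : i \in S ->
  (#|comps S| <= #|comps (S :\ i)%SET| + [exists C in comps S, i \in C])%N.
Proof.
move=> iS; pose A := finset (fun C : {set I} => (C \in comps S) && (i \in C)).
have A1 : (#|A| <= [exists C in comps S, i \in C])%N.
  case: (boolP [exists C in comps S, _]) => [_|/existsPn nex] /=.
    apply/card_le1_eqP => C D; rewrite [C \in A]inE [D \in A]inE.
    by move=> /andP[CS iC] /andP[DS iD]; apply: (comps_eq_of_meet DS CS iD iC).
  rewrite leqn0 finset.cards_eq0; apply/eqP/finset.setP => C; rewrite !inE;
    apply/negbTE.
  by have := nex C; rewrite inE.
apply: leq_trans (leq_add (leqnn _) A1);
  apply: leq_trans (finset.leq_card_setU _ _).
apply/subset_leq_card/fintype.subsetP => C CS; rewrite finset.in_setU.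
case: (boolP (i \in C)) => iC; first by rewrite [_ \in A]inE CS iC orbT.
apply/orP; left; have /compsP[cC QC] := CS; apply/compsP; split => //.
apply: component_setD cC => x /=; rewrite !inE; last by case/andP.
move=> xC; apply/andP; split; first by apply: contraNneq iC => <-.
by have /compsP[[_ + _ _] _] := CS; apply.
Qed.

(** A component without a neighbour of [i] survives the insertion of [i]. The others each contain a
    neighbour of [i], and a transversal of such neighbours is independent. *)
Lemma card_comps_add S i c0 : i \notin S ->
  (forall J : {set I}, (forall x, x \in J -> E x i) -> independent_set J ->
    (#|J| <= c0)%N) ->
  (#|comps S| <= #|comps (i |: S)%SET| +
     c0 * [exists C in comps S, [exists x in C, E x i]])%N.
Proof.
move=> iS ind.
pose A := finset (fun C : {set I} => (C \in comps S) && [exists x in C, E x i]).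
have A1 : (#|A| <= c0 * [exists C in comps S, [exists x in C, E x i]])%N.
  case: (boolP [exists C in comps S, _]) => [_|/existsPn nex] /=.
    rewrite muln1; have [||J [<- JE Jind]] := @comps_transversal S A (E ^~ i).
    - by apply/fintype.subsetP => C; rewrite [_ \in A]inE => /andP[].
    - by move=> C; rewrite inE => /andP[_ /existsP[x /andP[]]]; exists x.
    - exact: ind.
  rewrite muln0 leqn0 finset.cards_eq0; apply/eqP/finset.setP => C.
  by rewrite [LHS]inE finset.in_set0; apply/negbTE; have := nex C.
apply: leq_trans (leq_add (leqnn _) A1);
  apply: leq_trans (finset.leq_card_setU _ _).
apply/subset_leq_card/fintype.subsetP => C CS; rewrite finset.in_setU.
case: (boolP [exists x in C, E x i]) => iC;
  first by rewrite [_ \in A]inE CS iC orbT.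
apply/orP; left; have /compsP[cC QC] := CS; apply/compsP; split => //.
apply: component_setU cC => [x|x y] /=; rewrite !inE; first by move=> ->;
  rewrite orbT.
move=> xC /orP[/eqP -> _|-> //]; apply/negP.
by move/existsPn: iC => /(_ x); rewrite xC.
Qed.

Section self_bounding.
Context {R : realType}.
Variable p : I -> R.
Hypothesis p01 : forall i, 0 <= p i <= 1.
Variables (k c0 : nat) (sigma : R).
Hypothesis sigma0 : 0 <= sigma.
Hypothesis Qk : forall C, Q C -> (#|C| <= k)%N.
Hypothesis Eind : forall i (J : {set I}),
  (forall x, x \in J -> E x i) -> independent_set J -> (#|J| <= c0)%N.
Hypothesis psigma : forall x, \sum_(i | E x i) p i <= sigma.

Let f S : R := #|comps S|%:R.

Lemma comps_jump i S :
  `|f (i |: S)%SET - f (S :\ i)%SET| <= (maxn 1 c0)%:R.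
Proof.
have H1 := @card_comps_rem (i |: S)%SET i (finset.setU11 _ _).
have iS : i \notin (S :\ i)%SET by rewrite !inE eqxx.
have H2 := card_comps_add iS (@Eind i).
rewrite setD1_setU1 in H1; rewrite setU1_setD1 in H2; rewrite ler_distl /f.
apply/andP; split.
  rewrite lerBlDr -natrD ler_nat; apply: leq_trans H2 _.
  rewrite leq_add2l; apply: leq_trans (leq_maxr 1 c0).
  by rewrite -[leqRHS]muln1 leq_mul2l leq_b1 orbT.
rewrite -natrD ler_nat; apply: leq_trans H1 _.
by rewrite leq_add2l; apply: leq_trans (leq_maxl 1 c0); rewrite leq_b1.
Qed.

(** Let [U] be the union of the counted components, so [#|U| <= k * #|comps S|]. A deletion costs at
    most [1] and only for [i] in [U]; an insertion costs at most [c0] and only next to [U]. Summing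
    the squared insertion costs over the points of [U] first leaves the neighbourhood sums of [p],
    each at most [sigma]. *)
Lemma comps_vplus S :
  vplus p f S <= k%:R * (c0%:R ^+ 2 * sigma + 1) * f S.
Proof.
pose U := finset (fun x => [exists C in comps S, x \in C]).
have p0 i : 0 <= p i by case/andP: (p01 i).
have Uk : (#|U| <= k * #|comps S|)%N.
  have -> : U = finset.cover (comps S).
    apply/finset.setP => x; rewrite inE;
      apply/existsP/finset.bigcupP => [[C /andP[CS xC]]|[C CS xC]].
      by exists C.
    by exists C; rewrite CS.
  apply: leq_trans (finset.leq_card_cover _) _.
  rewrite mulnC -sum_nat_const; apply: leq_sum => C /compsP[_].
  exact: Qk.
have s0 : 0 <= c0%:R ^+ 2 * sigma + 1 by rewrite addr_ge0 // mulr_ge0 ?sqr_ge0.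
have v i : vplus_at p f i S <= (i \in U)%:R + c0%:R ^+ 2 * \sum_(x in U) (E x
  i)%:R * p i.
  have K0 : 0 <= \sum_(x in U) (E x i)%:R * p i.
    by apply: sumr_ge0 => x _; rewrite mulr_ge0.
  rewrite /vplus_at; case: (boolP (i \in S)) => iS.
    apply: (@le_trans _ _ (i \in U)%:R); last first.
      by rewrite lerDl mulr_ge0 // sqr_ge0.
    have /andP[pi0 pi1] := p01 i.
    have : Num.max 0 (f S - f (S :\ i)%SET) <= (i \in U)%:R.
      rewrite ge_max ler0n lerBlDl -natrD ler_nat.
      by have := card_comps_rem iS; rewrite [_ \in U]inE.
    have : 0 <= Num.max 0 (f S - f (S :\ i)%SET) by rewrite le_max lexx.
    move: (Num.max _ _) => M; case: (i \in U) => /= m0;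
      rewrite ?mulr1n ?mulr0n => m1; nra.
  apply: (@le_trans _ _ (c0%:R ^+ 2 * \sum_(x in U) (E x i)%:R * p i));
    last by rewrite lerDr.
  set b := [exists C in comps S, [exists x in C, E x i]].
  have mb : Num.max 0 (f S - f (i |: S)%SET) <= (c0 * b)%:R.
    rewrite ge_max ler0n lerBlDl -natrD ler_nat.
    exact: (card_comps_add iS (@Eind i)).
  have m0 : 0 <= Num.max 0 (f S - f (i |: S)%SET) by rewrite le_max lexx.
  apply: (@le_trans _ _ (c0%:R ^+ 2 * (b%:R * p i))).
    rewrite [leRHS](_ : _ = p i * (c0 * b)%:R ^+ 2).
      by rewrite ler_wpM2l // lerXn2r // nnegrE.
    by rewrite natrM; case: b {mb} => /=; ring.
  rewrite ler_wpM2l ?sqr_ge0 //.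
  case: (boolP b) => [/existsP[C /andP[CS /existsP[x /andP[xC xi]]]]|_];
    last by rewrite mul0r.
  have xU : x \in U by rewrite inE; apply/existsP; exists C; rewrite CS.
  rewrite (bigD1 x) //= xi lerDl; apply: sumr_ge0 => y _; rewrite mulr_ge0 //.
apply: (@le_trans _ _ ((c0%:R ^+ 2 * sigma + 1) * #|U|%:R)).
  apply: le_trans (ler_sum _ (fun i _ => v i)) _.
  rewrite big_split /= addrC mulrDl mul1r; apply: lerD; last first.
    rewrite -natr_sum ler_nat -sum1_card [leqRHS]big_mkcond /=.
    by apply: leq_sum => i _; case: ifP.
  rewrite -mulr_sumr -mulrA ler_wpM2l ?sqr_ge0 // exchange_big /=.
  rewrite mulr_natr -sumr_const; apply: ler_sum => x xU.
  apply: le_trans (psigma x); rewrite [leRHS]big_mkcond /=.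
  by apply: ler_sum => i _; case: (E x i); rewrite ?mul1r ?mul0r.
by rewrite -mulrA mulrCA ler_wpM2l // -natrM ler_nat.
Qed.

End self_bounding.
End component_count.

Lemma counting_eq (R : realType) (T : choiceType) (A : set T) (n : nat) :
  (A #= `I_n)%card -> counting A = n%:R%:E :> \bar R.
Proof.
move=> An; rewrite /counting asboolT; last by apply/finite_setP; exists n.
by rewrite (card_fset_set An).
Qed.

Lemma card_set_pred (I : finType) (X : {set I}) : ([set` X] #= `I_#|X|)%card.
Proof.
have -> : [set` X] = (@enum_val I (mem X)) @` [set: 'I_#|X|].
  apply/seteqP; split=> [x xX|_ [i _ <-]]; last exact: enum_valP.
  by exists (enum_rank_in xX x) => //; rewrite enum_rankK_in.
have inj : {in [set: 'I_#|X|] &, injective (@enum_val I (mem X))}.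
  by move=> i j _ _; exact: enum_val_inj.
exact: card_eq_trans (inj_card_eq inj) (card_esym card_II).
Qed.

Lemma component_image (T U : Type) (g : T -> U) (V : set T)
    (E : T -> T -> Prop) (e : U -> U -> Prop) (C : set T) :
  (forall x y, V x -> V y -> g x = g y -> x = y) ->
  (forall x y, V x -> V y -> (E x y <-> e (g x) (g y))) ->
  component V E C -> component (g @` V) e (g @` C).
Proof.
move=> ginj gE [[x0 Cx0] CV con cl]; split.
- by exists (g x0); exists x0.
- by move=> _ [x Cx <-]; exists x => //; exact: CV.
- move=> _ _ [x Cx <-] [y Cy <-]; have [s [sp <-]] := con _ _ Cx Cy.
  exists (map g s); split; last by rewrite last_map.
  elim: s x Cx sp {y Cy} => //= v s IH x Cx /andP[/asboolP[Cv Exv] sp].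
  apply/andP; split; last exact: IH.
  by apply/asboolP; split; [exists v|apply/gE => //; exact: CV].
- move=> _ _ [x Cx <-] [y Vy <-] nCy; rewrite -gE //; last exact: CV.
  by apply: cl => // Cy; apply: nCy; exists y.
Qed.

(** * Transport of component counts along graph isomorphisms *)

Section transport.
(** The kind of component, as a property of graphs on arbitrary types: the same [Q] must apply to
    sets of points in space and to sets of cells. *)
Variable Q : forall T : Type, set T -> (T -> T -> Prop) -> Prop.
Hypothesis Qiso : forall (T U : Type) (C : set T) E (D : set U) E',
  graph_isomorphic C E D E' -> Q C E -> Q D E'.

Lemma graph_prop_image (T U : Type) (g : T -> U) (C : set T)
    (E : T -> T -> Prop) (e : U -> U -> Prop) :
  (forall x y, C x -> C y -> g x = g y -> x = y) ->
  (forall x y, C x -> C y -> (E x y <-> e (g x) (g y))) ->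
  Q C E -> Q (g @` C) e.
Proof.
move=> ginj gE; apply: Qiso; exists g; split => //; split => //.
by move=> x y /set_mem Cx /set_mem Cy; exact: ginj.
Qed.

(** On [V] the map [g] is a graph isomorphism onto [S], so taking images is a bijection between
    components; [W] and [w] express one and the same window on the two sides. *)
Lemma counting_comps (R : realType) (T : pointedType) (I : finType) (g : T -> I)
    (V : set T) (E : T -> T -> Prop) (W : set T) (S : {set I}) (e : rel I) (w :
      pred I) :
  (forall x y, V x -> V y -> g x = g y -> x = y) ->
  [set` S] = g @` V ->
  (forall x y, V x -> V y -> (E x y <-> e (g x) (g y))) ->
  (forall x, V x -> (W x <-> w (g x))) ->
  counting [set C | (component V E C /\ Q C E) /\ C `<=` W] =
  #|comps e (fun C => Q [set` C] e /\ (forall i, i \in C ->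
    w i)) S|%:R%:E :> \bar R.
Proof.
move=> ginj SV gE gW; apply: counting_eq.
set X := comps _ _ _; set A := [set C | _].
apply: card_eq_trans (card_set_pred X).
pose phi (C : set T) : {set I} := finset (fun i => `[< (g @` C) i >]).
have phiE C : [set` phi C] = g @` C.
  apply/seteqP; split=> i /=; first by rewrite inE => /asboolP.
  by move=> gCi; rewrite inE; apply/asboolP.
have AV C : A C -> C `<=` V by move=> [[[_ CV _ _] _] _].
have phi_inj : {in A &, injective phi}.
  have H C D : A C -> A D -> phi C = phi D -> C `<=` D.
    move=> AC AD CD x Cx; have : [set` phi D] (g x) by rewrite -CD phiE;
      exists x.
    rewrite phiE => -[y Dy gyx]; rewrite -(ginj _ _ (AV _ AD _ Dy) (AV _ AC _
      Cx) gyx) //.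
  by move=> C D /set_mem AC /set_mem AD CD; apply/seteqP; split; exact: H.
have <- : phi @` A = [set` X]; last by rewrite card_eq_sym; exact: inj_card_eq.
(* The inverse of [g] on [S]; the default [point] is never met there. *)
pose h (i : I) : T := xget point [set x | V x /\ g x = i].
have hP i : [set` S] i -> V (h i) /\ g (h i) = i.
  rewrite SV => -[x Vx gx]; rewrite /h; case: xgetP => [y _ []//|/(_ x) []].
  by split.
apply/seteqP; split=> [_ [C [[cC QC] CW] <-]|D /= /compsP[cD [QD wD]]].
  have CV : C `<=` V by case: cC.
  apply/compsP; rewrite phiE SV; split; first exact: (component_image ginj gE
    cC).
  split=> [|i]; last first.
    rewrite inE => /asboolP[x Cx <-]; apply/gW; [exact: CV|exact: CW].
  by apply: graph_prop_image QC => x y Cx Cy; [apply: ginj|apply: gE];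
    exact: CV.
have hinj i j : [set` S] i -> [set` S] j -> h i = h j -> i = j.
  by move=> /hP[_ {2}<-] /hP[_ {2}<-] ->.
have DS : [set` D] `<=` [set` S] by case: cD.
have he i j : [set` S] i -> [set` S] j -> (e i j <-> E (h i) (h j)).
  by move=> /hP[Vi gi] /hP[Vj gj]; rewrite gE // gi gj.
have hV : h @` [set` S] = V.
  apply/seteqP; split=> [_ [i /hP[Vi _] <-]//|x Vx].
  have gxS : [set` S] (g x) by rewrite SV; exists x.
  exists (g x) => //; have [Vh gh] := hP _ gxS; exact: ginj.
exists (h @` [set` D]).
  split; first split.
  - by rewrite -[V]hV; exact: (component_image hinj he cD).
  - by apply: graph_prop_image QD => i j Di Dj; [apply: hinj|apply: he];
    exact: DS.
  - move=> _ [i Di <-]; have [Vi gi] := hP _ (DS _ Di).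
    by apply/gW => //; rewrite gi; exact: wD.
apply/finset.setP => i; rewrite inE; apply/asboolP/idP => [[_ [j Dj <-] <-]|iD].
  by have [_ ->] := hP _ (DS _ Dj).
by exists (h i); [exists i|have [] := hP _ (DS _ iD)].
Qed.

End transport.

(** * Euclidean geometry of the cells *)

Section euclidean.
Context {R : realType} {d : nat}.
Implicit Types (x y z u v : 'rV[R]_d) (rho s : R).

Lemma coord_le_enorm u i : `|u ord0 i| <= enorm u.
Proof.
rewrite -sqrtr_sqr ler_wsqrtr // (bigD1 i) //= lerDl.
by apply: sumr_ge0 => j _; exact: sqr_ge0.
Qed.

(** A side of [rho / d] instead of [rho / sqrt d] avoids a root and makes the number of grid steps
    in a cube of side [2 L rho] the integer [2 L d]. *)
Lemma enorm_le u rho : (0 < d)%N -> 0 <= rho ->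
  (forall i, `|u ord0 i| * d%:R <= rho) -> enorm u <= rho.
Proof.
move=> d0 rho0 H; rewrite -[rho]ger0_norm // -sqrtr_sqr ler_wsqrtr //.
have d1 : (1 : R) <= d%:R by rewrite ler1n.
apply: (@le_trans _ _ (\sum_(i < d) rho ^+ 2 / d%:R)); last first.
  by rewrite sumr_const card_ord -[leLHS]mulr_natr -mulrA mulVf ?mulr1 //
    pnatr_eq0 -lt0n.
apply: ler_sum => i _; rewrite ler_pdivlMr ?ltr0n //.
have := H i; have := normr_ge0 (u ord0 i); rewrite -real_normK ?num_real //.
move: `|_| (d%:R : R) d1 => t D D1 t0 tD.
have : (t * D) * (t * D) <= rho * rho by apply: ler_pM => //; nra.
have : t ^+ 2 * D <= t ^+ 2 * D * D by rewrite ler_peMr // mulr_ge0 ?sqr_ge0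
  //; lra.
rewrite expr2; lra.
Qed.

Lemma coord_continuousB x (i : 'I_d) :
  continuous (fun y : 'rV[R]_d => (y - x) ord0 i).
Proof.
move=> y; rewrite (_ : (fun y : 'rV[R]_d => _) = (fun y =>
  y ord0 i - x ord0 i)).
  exact: (cvgB (@coord_continuous R 1 d ord0 i y) (cvg_cst _)).
by apply/funext => z; rewrite !mxE.
Qed.

Lemma enormB_continuous x : continuous (fun y : 'rV[R]_d => enorm (y - x)).
Proof.
move=> y.
have sq i : (z - x) ord0 i ^+ 2 @[z --> y] --> (y - x) ord0 i ^+ 2.
  exact: (cvgM (@coord_continuousB x i y) (@coord_continuousB x i y)).
have sumsq : \sum_(i < d) (z - x) ord0 i ^+ 2 @[z --> y] --> \sum_(i < d) (y -
  x) ord0 i ^+ 2.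
  apply: (@cvg_big R _ +%R 0 xpredT _ _ (nbhs y) _ (fun i z =>
    (z - x) ord0 i ^+ 2) _ (nbhs_filter y)) => [|i _].
    exact: add_continuous.
  exact: sq.
exact: (cvg_comp _ _ sumsq (@sqrt_continuous R _)).
Qed.

Lemma measurable_closed_eball x rho :
  measurable (closed_eball x rho : set (borelRd R d)).
Proof.
rewrite -[closed_eball x rho]setCK; apply: measurableC;
  apply: sub_sigma_algebra.
apply: closed_openC; rewrite /closed_eball.
apply: (@closed_comp _ _ (fun y : 'rV[R]_d =>
  enorm (y - x)) [set t | t <= rho]).
  by move=> y _; exact: enormB_continuous.
exact: closed_le.
Qed.

Lemma measurable_coord_ge (i : 'I_d) (t : R) :
  measurable ([set y : 'rV[R]_d | t <= y ord0 i] : set (borelRd R d)).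
Proof.
rewrite -[X in measurable X]setCK; apply: measurableC; apply: sub_sigma_algebra.
apply: closed_openC.
apply: (@closed_comp _ _ (fun y : 'rV[R]_d => y ord0 i) [set s | t <= s]).
  by move=> y _; exact: (@coord_continuous R 1 d ord0 i y).
exact: closed_ge.
Qed.

Lemma enorm_far x y rho : rho < enorm (x - y) ->
  \forall e \near 0^'+, forall x' y' : 'rV[R]_d,
    (forall i, `|x ord0 i - x' ord0 i| <= e) ->
    (forall i, `|y ord0 i - y' ord0 i| <= e) -> rho < enorm (x' - y').
Proof.
move=> xy.
have : \forall u \near (x - y), rho < enorm u.
  have := @enormB_continuous 0 (x - y).
  rewrite /continuous_at subr0 => /cvgr_gt /(_ _ xy).
  by apply: filterS => u; rewrite subr0.
case/nbhs_ballP => e /= e0 He; near=> t => x' y' xx' yy'.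
apply: He; split => // i j; rewrite (ord1 i) /ball /= !mxE.
have -> : x ord0 j - y ord0 j - (x' ord0 j - y' ord0 j) =
  (x ord0 j - x' ord0 j) - (y ord0 j - y' ord0 j) by ring.
apply: (@le_lt_trans _ _ (t + t)).
  by apply: le_trans (ler_normB _ _) _; rewrite lerD.
have : t < e / 2 by near: t; apply: nbhs_right_lt; rewrite divr_gt0.
lra.
Unshelve. all: by end_near. Qed.

End euclidean.

(** * Grids, packing and covering *)

Section grid.
Context {R : realType} {d : nat}.
Implicit Types (x y z b : 'rV[R]_d) (rho s : R) (K L M n : nat).

(** The corner is [b] and the mesh [1 / s]. There are [K + 1] indices per axis since the closed
    upper face has an index of its own; outside [in_grid], [inord] and [truncn] return meaningless
    values. *)
Definition grid_index K b s y : {ffun 'I_d -> 'I_K.+1} :=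
  [ffun i => inord (Num.truncn ((y ord0 i - b ord0 i) * s))].

Definition in_grid K b s y : Prop :=
  forall i, 0 <= (y ord0 i - b ord0 i) * s <= K%:R.

Lemma grid_indexP K b s y q : in_grid K b s y ->
  grid_index K b s y = q <->
  forall i, (q i)%:R <= (y ord0 i - b ord0 i) * s < (q i).+1%:R.
Proof.
move=> yK.
have val i : val (grid_index K b s y i) = Num.truncn ((y ord0 i - b ord0 i) *
  s).
  rewrite ffunE /= inordK // ltnS truncn_le_nat.
  by have /andP[_ /le_lt_trans] := yK i; apply; rewrite ltr_nat.
split=> [<- i|H].
  by rewrite val; apply: truncn_itv; have /andP[] := yK i.
by apply/ffunP => i; apply/val_inj; rewrite val; apply: truncn_def; exact: H.
Qed.

Lemma grid_index_close K b s y z : 0 <= s -> in_grid K b s y ->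
  in_grid K b s z ->
  grid_index K b s y = grid_index K b s z ->
  forall i, `|y ord0 i - z ord0 i| * s < 1.
Proof.
move=> s0 yK zK yz i.
have /(_ i) := (grid_indexP (grid_index K b s z) yK).1 yz.
have /(_ i) := (grid_indexP (grid_index K b s z) zK).1 erefl.
rewrite -natr1 => /andP[z1 z2] /andP[y1 y2].
have -> : `|y ord0 i - z ord0 i| * s = `|(y ord0 i - z ord0 i) * s| by rewrite
  normrM (ger0_norm s0).
by rewrite ltr_norml; apply/andP; split; lra.
Qed.

Lemma in_grid_ball rho x0 L y : 0 < rho ->
  (forall i, `|y ord0 i - x0 ord0 i| <= L%:R * rho) ->
  in_grid (2 * L * d) (x0 - const_mx (L%:R * rho)) (d%:R / rho) y.
Proof.
move=> rho0 H i; have := H i; rewrite !mxE ler_norml => /andP[h1 h2].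
have D0 : 0 <= d%:R / rho :> R by rewrite divr_ge0 // ltW.
rewrite mulr_ge0 //=; last by lra.
have -> : (2 * L * d)%:R = (2 * (L%:R * rho)) * (d%:R / rho) :> R.
  by rewrite !natrM; field; rewrite gt_eqF.
by apply: ler_wpM2r => //; lra.
Qed.

(* The grid has mesh [rho / d], so its cubes have Euclidean diameter at most
   [rho]. *)
Lemma grid_index_ball_close rho x0 L y z : (0 < d)%N -> 0 < rho ->
  (forall i, `|y ord0 i - x0 ord0 i| <= L%:R * rho) ->
  (forall i, `|z ord0 i - x0 ord0 i| <= L%:R * rho) ->
  let g := grid_index (2 * L * d) (x0 - const_mx (L%:R * rho)) (d%:R / rho) in
  g y = g z -> enorm (y - z) <= rho.
Proof.
move=> d0 rho0 hy hz g gyz.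
have D0 : 0 <= d%:R / rho :> R by rewrite divr_ge0 // ltW.
have H := grid_index_close D0 (in_grid_ball rho0 hy) (in_grid_ball rho0 hz) gyz.
apply: enorm_le => // [|i]; first exact: ltW.
by have := H i; rewrite !mxE mulrA ltr_pdivrMr // mul1r => /ltW.
Qed.

(** Packing by pigeonhole: two points in one grid cube would be at distance at most [rho]. *)
Lemma card_separated (I : finType) (J : {set I}) (c : I -> 'rV[R]_d) rho x0 L :
  (0 < d)%N -> 0 < rho ->
  (forall j, j \in J -> forall i, `|c j ord0 i - x0 ord0 i| <= L%:R * rho) ->
  (forall j j', j \in J -> j' \in J -> j != j' -> rho < enorm (c j - c j')) ->
  (#|J| <= (2 * L * d).+1 ^ d)%N.
Proof.
move=> d0 rho0 cL csep.
pose g := grid_index (2 * L * d) (x0 - const_mx (L%:R * rho)) (d%:R / rho).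
have ginj : {in J &, injective (g \o c)}.
  move=> j j' jJ j'J /= gjj'; apply/eqP; apply: contraT => jj'.
  have := csep _ _ jJ j'J jj'.
  by rewrite ltNge (grid_index_ball_close d0 rho0 (cL _ jJ) (cL _ j'J) gjj').
rewrite -(finset.card_in_imset ginj); apply: leq_trans (max_card _) _.
by rewrite card_ffun !card_ord.
Qed.

End grid.

Lemma fsum_finType (R : Type) (idx : R) (op : Monoid.com_law idx) (I : finType)
    (A : pred I) (F : I -> R) :
  \big[op/idx]_(i \in [set` A]) F i = \big[op/idx]_(i | A i) F i.
Proof.
rewrite -(big_enum _ _ A) /= [RHS]fsbig_seq ?enum_uniq //.
rewrite (_ : [set` enum A] = [set` A]) //.
by apply/seteqP; split=> i /=; rewrite mem_enum.
Qed.

Lemma measure_le_covering (R : realType) (d : nat)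
    (mu : {measure set (borelRd R d) -> \bar R}) (A : set 'rV[R]_d)
    (rho : R) (x0 : 'rV[R]_d) (L : nat) :
  (0 < d)%N -> 0 < rho -> measurable (A : set (borelRd R d)) ->
  (forall y, A y -> forall i, `|y ord0 i - x0 ord0 i| <= L%:R * rho) ->
  (mu A <= ((2 * L * d).+1 ^ d)%:R%:E * sup_ball_measure mu rho)%E.
Proof.
move=> d0 rho0 mA AL.
pose g := grid_index (2 * L * d) (x0 - const_mx (L%:R * rho)) (d%:R / rho).
(* Each ball is centred at a point of [A] in its cube and thus covers that part of [A]. For a cube
   that misses [A] the centre defaults to [0], which is harmless as every ball obeys the
   supremum. *)
pose c q := xget 0 [set y | A y /\ g y = q].
have cP y : A y -> closed_eball (c (g y)) rho y.
  move=> Ay; rewrite /c /closed_eball /=;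
    case: xgetP => [z _ [Az gz]|/(_ y)[]//].
  exact: (grid_index_ball_close d0 rho0 (AL _ Ay) (AL _ Az)).
have := @content_sub_fsum _ R _ mu _ [set: {ffun 'I_d -> 'I_(2 * L * d).+1}]
  A (fun q => closed_eball (c q) rho) finite_finset.
move=> /(_ (fun i _ => @measurable_closed_eball R d _ _) mA) /(_ _) /le_trans;
  apply.
  by move=> y Ay; exists (g y) => //; exact: cP.
have -> : [set: {ffun 'I_d -> 'I_(2 * L * d).+1}] = [set` predT] by
  apply/seteqP; split.
rewrite fsum_finType.
apply: (@le_trans _ _ (\sum_(q : {ffun 'I_d ->
  'I_(2 * L * d).+1}) sup_ball_measure mu rho)%E).
  by apply: lee_sum => q _; apply: ereal_sup_ubound; exists (c q).
by rewrite sumr_const card_ffun !card_ord mule_natl.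
Qed.

Lemma near_finite (T : choiceType) (U : Type) (F : set_system U) (V : set T)
    (P : T -> U -> Prop) : Filter F -> finite_set V ->
  (forall x, V x -> \forall n \near F, P x n) ->
  \forall n \near F, forall x, V x -> P x n.
Proof.
move=> FF /finite_fsetP[X ->] H; rewrite /prop_near1 /=.
have := @filter_bigI U T X (fun x => [set n | P x n]) F FF H.
by apply: filterS => n Hn x xX; exact: Hn.
Qed.

(** * Cells of a window and their adjacency *)

Section cells.
Context {R : realType} {d : nat}.
Variables (M n : nat).
Implicit Types (y z : 'rV[R]_d) (rho : R).

Definition box : set 'rV[R]_d := [set y | forall i, `|y ord0 i| <= M%:R].

Local Notation index := {ffun 'I_d -> 'I_(2 * M * n.+1).+1}.
Implicit Types q r : index.

Definition cell_index y : index :=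
  grid_index (2 * M * n.+1) (const_mx (- M%:R)) n.+1%:R y.

Definition cell q : set 'rV[R]_d := [set y | box y /\ cell_index y = q].

Lemma box_in_grid y : box y -> in_grid (2 * M * n.+1) (const_mx (- M%:R))
  n.+1%:R y.
Proof.
move=> By i; have := By i; rewrite mxE ler_norml => /andP[h1 h2].
rewrite opprK mulr_ge0 ?natrM //=; last by lra.
by apply: ler_wpM2r => //; lra.
Qed.

Lemma cell_close q y z : cell q y -> cell q z ->
  forall i, `|y ord0 i - z ord0 i| < n.+1%:R^-1.
Proof.
move=> [By yq] [Bz zq] i.
have yz : cell_index y = cell_index z by rewrite yq zq.
have := grid_index_close (ler0n R n.+1) (box_in_grid By) (box_in_grid Bz) yz i.
by rewrite -ltr_pdivlMr // div1r.
Qed.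

Lemma trivIset_cell : trivIset setT cell.
Proof. by move=> q r _ _ [y [[_ <-] [_ <-]]]. Qed.

Lemma measurable_coordP (P : 'I_d -> set 'rV[R]_d) :
  (forall i, measurable (P i : set (borelRd R d))) ->
  measurable ([set y | forall i, P i y] : set (borelRd R d)).
Proof.
move=> mP; rewrite (_ : [set y | _] = \bigcap_(i in [set: 'I_d]) P i).
  by apply: fin_bigcap_measurable => //; exact: finite_finset.
by apply/seteqP; split=> [y H i _|y H i]; [exact: H|exact: (H i)].
Qed.

Lemma measurable_coord_le (i : 'I_d) (t : R) :
  measurable ([set y : 'rV[R]_d | y ord0 i <= t] : set (borelRd R d)).
Proof.
rewrite -[X in measurable X]setCK; apply: measurableC; apply: sub_sigma_algebra.
apply: closed_openC.
apply: (@closed_comp _ _ (fun y : 'rV[R]_d => y ord0 i) [set s | s <= t]).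
  by move=> y _; exact: (@coord_continuous R 1 d ord0 i y).
exact: closed_le.
Qed.

Lemma measurable_box : measurable (box : set (borelRd R d)).
Proof.
apply: (measurable_coordP (P := fun i => [set y | `|y ord0 i| <= M%:R])) => i.
rewrite [X in measurable X](_ : _ = [set y : 'rV[R]_d | - M%:R <= y ord0 i] `&`
                          [set y : 'rV[R]_d | y ord0 i <= M%:R]).
  by apply: measurableI; [exact: measurable_coord_ge|
    exact: measurable_coord_le].
by apply/seteqP; split=> [y /=|y [/= h1 h2]];
  rewrite ler_norml ?h1 // => /andP[].
Qed.

Lemma measurable_cell q : measurable (cell q : set (borelRd R d)).
Proof.
rewrite [X in measurable X](_ : _ = box `&` [set y | forall i,
    ([set y : 'rV[R]_d | (q i)%:R / n.+1%:R - M%:R <= y ord0 i] `\`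
     [set y : 'rV[R]_d | (q i).+1%:R / n.+1%:R - M%:R <= y ord0 i]) y]).
  apply: measurableI; first exact: measurable_box.
  apply: (measurable_coordP (P := fun i =>
    [set y : 'rV[R]_d | (q i)%:R / n.+1%:R - M%:R <= y ord0 i] `\`
    [set y : 'rV[R]_d | (q i).+1%:R / n.+1%:R - M%:R <= y ord0 i])) => i.
  by apply: measurableD; exact: measurable_coord_ge.
have n0 : (0 : R) < n.+1%:R by [].
apply/seteqP; split=> [y [By yq]|y [By H]]; split => //.
  move=> i; have /(_ i) := (grid_indexP q (box_in_grid By)).1 yq.
  rewrite mxE opprK -ler_pdivrMr // -ltr_pdivlMr // => /andP[h1 h2];
    split => /=.
    by rewrite lerBlDr.
  by apply/negP; rewrite -ltNge ltrBrDr.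
apply/(grid_indexP q (box_in_grid By)) => i; have [/= h1 /negP h2] := H i.
rewrite mxE opprK -ler_pdivrMr // -ltr_pdivlMr // -lerBlDr h1 /=.
by rewrite -ltrBrDr ltNge.
Qed.

Lemma bounded_box : bounded_set box.
Proof.
exists M%:R; split; first exact: num_real.
move=> t Mt y By; apply: le_trans (ltW Mt).
rewrite /Num.norm /= mx_normrE; apply: bigmax_le => // -[i j] _ /=.
by rewrite ord1.
Qed.

Lemma bounded_cell q : bounded_set (cell q).
Proof.
have [t [tr H]] := bounded_box; exists t; split => // u tu y [By _].
exact: H By.
Qed.

(** The witnesses are arbitrary points of the cells, not points of the process, so the graph is
    deterministic and randomness enters only through the set of occupied vertices. *)
Definition cell_edge rho : rel index :=
  [rel q r | (q != r) && `[< exists y z, [/\ cell q y,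
    cell r z & enorm (y - z) <= rho] >]].

Lemma enormB y z : enorm (y - z) = enorm (z - y).
Proof.
by congr Num.sqrt; apply: eq_bigr => i _; rewrite -sqrrN !mxE opprB.
Qed.

Lemma cell_edge_sym rho : symmetric (cell_edge rho).
Proof.
move=> q r; rewrite /cell_edge /= eq_sym; congr andb.
by apply/asboolP/asboolP => -[y [z [cy cz yz]]]; exists z, y; split;
  rewrite // enormB.
Qed.

(** The two witnesses contribute [rho] and each of the two cells at most [rho / 2]; the total
    [2 rho] is the [L = 2] in the dimensional constant. *)
Lemma cell_edge_close rho q r y z : 2 <= n.+1%:R * rho ->
  cell_edge rho q r -> cell q y -> cell r z ->
  forall i, `|z ord0 i - y ord0 i| <= 2%:R * rho.
Proof.
move=> nrho /andP[_ /asboolP[y' [z' [cy' cz' yz']]]] cy cz i.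
have h1 := cell_close cy cy' i; have h2 := cell_close cz cz' i.
have h3 : `|y' ord0 i - z' ord0 i| <= rho.
  by apply: le_trans yz'; have := coord_le_enorm (y' - z') i; rewrite !mxE.
have h4 : n.+1%:R^-1 <= rho / 2.
  by move: nrho; rewrite -div1r ler_pdivrMr //; move: (n.+1%:R : R) => N; lra.
move: h1 h2 h3 h4; move: (n.+1%:R^-1 : R) => e;
  rewrite !(ltr_norml, ler_norml) => /andP[? ?] /andP[? ?] /andP[? ?] ?.
by apply/andP; split; lra.
Qed.

Definition pt (q : index) : 'rV[R]_d := xget 0 (cell q).

Lemma cell_pt q : cell q !=set0 -> cell q (pt q).
Proof. by case=> y cy; rewrite /pt; apply: xgetPex; exists y. Qed.

Lemma pt_separated rho q r : cell q !=set0 -> cell r !=set0 -> q != r ->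
  ~~ cell_edge rho q r -> rho < enorm (pt q - pt r).
Proof.
move=> q0 r0 qr; rewrite ltNge; apply: contra => H.
rewrite /cell_edge /= qr; apply/asboolP; exists (pt q), (pt r).
by split => //; exact: cell_pt.
Qed.

Lemma card_independent_nbr rho q (J : {set index}) : (0 < d)%N -> 0 < rho ->
  2 <= n.+1%:R * rho ->
  (forall r, r \in J -> cell_edge rho r q) ->
    independent_set (cell_edge rho) J ->
  (#|J| <= (2 * 2 * d).+1 ^ d)%N.
Proof.
move=> d0 rho0 nrho Jq Jind.
have ne r : r \in J -> cell r !=set0 /\ cell q !=set0.
  by move=> /Jq /andP[_ /asboolP[y [z [cy cz _]]]]; split; [exists y|exists z].
apply: (@card_separated R d _ J pt rho (pt q)) => //.
- move=> r rJ i; have [r0 q0] := ne _ rJ.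
  by apply: (cell_edge_close nrho _ (cell_pt q0) (cell_pt r0));
    rewrite cell_edge_sym Jq.
- move=> r r' rJ r'J rr'; have [r0 _] := ne _ rJ; have [r'0 _] := ne _ r'J.
  by apply: pt_separated => //; exact: Jind.
Qed.

(** The bound depends on the window but not on the mesh [n]; it will provide the dominating constant
    as the mesh vanishes. *)
Lemma card_independent_box rho L (J : {set index}) : (0 < d)%N -> 0 < rho ->
  M%:R <= L%:R * rho ->
  (forall r, r \in J -> cell r !=set0) -> independent_set (cell_edge rho) J ->
  (#|J| <= (2 * L * d).+1 ^ d)%N.
Proof.
move=> d0 rho0 ML J0 Jind.
apply: (@card_separated R d _ J pt rho 0) => //.
- move=> r rJ i; rewrite mxE subr0; apply: le_trans ML.
  by have [+ _] := cell_pt (J0 _ rJ); apply.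
- move=> r r' rJ r'J rr'.
  by apply: pt_separated => //; [exact: J0|exact: J0|exact: Jind].
Qed.

(** The neighbouring cells are disjoint and their union lies within [2 rho] of [pt q] in each
    coordinate, so the covering bound with [L = 2] applies to its mass. *)
Lemma sum_nbr_le (mu : {measure set (borelRd R d) -> \bar R}) rho q
    (p : index -> R) : (0 < d)%N -> 0 < rho -> 2 <= n.+1%:R * rho ->
  (sup_ball_measure mu rho < +oo)%E ->
  (forall r, (p r)%:E <= mu (cell r))%E ->
  \sum_(r | cell_edge rho q r) p r <=
    ((2 * 2 * d).+1 ^ d)%:R * fine (sup_ball_measure mu rho).
Proof.
move=> d0 rho0 nrho sfin pmu.
have s0 : (0 <= sup_ball_measure mu rho)%E.
  by apply: le_trans (measure_ge0 mu (closed_eball 0 rho)) _;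
    apply: ereal_sup_ubound; exists 0.
rewrite -lee_fin EFinM fineK ?ge0_fin_numE // -sumEFin.
apply: (@le_trans _ _ (\sum_(r | cell_edge rho q r) mu (cell r))%E).
  by apply: lee_sum => r _.
rewrite -fsum_finType -measure_fin_bigcup; last first.
- by move=> r _; exact: measurable_cell.
- by apply: sub_trivIset trivIset_cell.
- exact: finite_finset.
have mU : measurable (\bigcup_(r in [set` cell_edge rho q]) cell r : set
  (borelRd R d)).
  by apply: fin_bigcup_measurable => [|r _];
    [exact: finite_finset|exact: measurable_cell].
apply: (@measure_le_covering R d mu _ rho (pt q) 2 d0 rho0 mU).
move=> y [r /= qr cy] i.
have q0 : cell q !=set0 by move: qr => /andP[_ /asboolP[y' [z [cy' _ _]]]];
  exists y'.
exact: (cell_edge_close nrho qr (cell_pt q0) cy).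
Qed.

End cells.

(** * Fine meshes resolve a finite configuration *)

Section fine_mesh.
Context {R : realType} {d : nat}.
Variables (M : nat) (V : set 'rV[R]_d).
Hypotheses (Vfin : finite_set V) (VM : V `<=` box M).
Implicit Types (x y : 'rV[R]_d) (rho : R).

Lemma near_cell_index_inj : \forall n \near \oo,
  forall x, V x -> forall y, V y -> cell_index M n x = cell_index M n y ->
    x = y.
Proof.
apply: near_finite => // x Vx; apply: near_finite => // y Vy.
have [->|/eqP xy] := pselect (x = y); first by near=> n.
have /existsP[i xyi] : [exists i, x ord0 i != y ord0 i].
  rewrite -negb_forall; apply/negP => /forallP H; move/eqP: xy; apply.
  by apply/rowP => i; apply/eqP.
have t0 : 0 < `|x ord0 i - y ord0 i| by rewrite normr_gt0 subr_eq0.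
have := near_infty_natSinv_lt (PosNum t0); apply: filterS => n nt xyn.
have := cell_close (conj (VM Vx) xyn) (conj (VM Vy) erefl) i.
by rewrite ltNge (ltW nt).
Unshelve. all: by end_near. Qed.

Lemma near_cell_far rho : \forall n \near \oo,
  forall x, V x -> forall y, V y -> rho < enorm (x - y) ->
    ~~ cell_edge rho (cell_index M n x) (cell_index M n y).
Proof.
apply: near_finite => // x Vx; apply: near_finite => // y Vy.
have [xy|xy] := pselect (rho < enorm (x - y)); last by near=> n.
have := enorm_far xy; rewrite near_withinE => /nbhs_ballP[e /= e0 He].
have := near_infty_natSinv_lt (PosNum e0); apply: filterS => n ne _.
apply/negP => /andP[_ /asboolP[x' [y' [cx' cy' xy']]]].
have xx' i : `|x ord0 i - x' ord0 i| <= n.+1%:R^-1.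
  exact: ltW (cell_close (conj (VM Vx) erefl) cx' i).
have yy' i : `|y ord0 i - y' ord0 i| <= n.+1%:R^-1.
  exact: ltW (cell_close (conj (VM Vy) erefl) cy' i).
have := He n.+1%:R^-1; rewrite /ball /= sub0r normrN ger0_norm ?invr_ge0 // =>
  /(_ ne).
by rewrite invr_gt0 ltr0n => /(_ erefl x' y' xx' yy'); rewrite ltNge xy'.
Unshelve. all: by end_near. Qed.

(** A cell only reveals whether it meets [box m]. A point outside this closed box has positive
    distance from it, so its cell eventually misses the box. *)
Lemma near_cell_window (m : nat) : \forall n \near \oo,
  forall x, V x -> (exists y, cell (cell_index M n x) y /\ box m y) -> box m x.
Proof.
apply: near_finite => // x Vx.
have [xm|/existsNP[i /negP]] := pselect (box m x); first by near=> n.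
rewrite -ltNge => xi.
have t0 : 0 < `|x ord0 i| - m%:R by rewrite subr_gt0.
have := near_infty_natSinv_lt (PosNum t0); apply: filterS => n nt [y [cy ym]].
have := cell_close (conj (VM Vx) erefl) cy i; have := ym i.
have := ler_normD (x ord0 i - y ord0 i) (y ord0 i); rewrite subrK.
move: nt => /=; move: (n.+1%:R^-1 : R) => e; lra.
Unshelve. all: by end_near. Qed.

End fine_mesh.

(** * Probability *)

Section laplace_limits.
Context {R : realType} {disp : measure_display} {Omega : measurableType disp}.
Variable P : probability Omega R.
Implicit Types (G : Omega -> R) (D : set Omega) (s c e : R).
Local Open Scope ereal_scope.

Lemma measurable_laplace D s G : measurable_fun D G ->
  measurable_fun D (fun w => (expR (s * G w))%:E : \bar R).
Proof.
move=> mG; apply/measurable_EFinP; apply: measurableT_comp => //.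
exact: measurable_funM.
Qed.

(** Used twice: for vanishing mesh, with [D] the whole space, and for growing windows, with [D] the
    event that the limit is finite. *)
Lemma laplace_fatou D (Gn : nat -> Omega -> R) G (en : nat -> R) s c e :
  measurable D -> (forall n, measurable_fun setT (Gn n)) ->
  (forall w, D w -> Gn n w @[n --> \oo] --> G w) ->
  en @ \oo --> e ->
  (\forall n \near \oo, \int[P]_w (expR (s * Gn n w))%:E <= (expR (c * en
    n))%:E) ->
  \int[P]_(w in D) (expR (s * G w))%:E <= (expR (c * e))%:E.
Proof.
move=> mD mG cG ce H.
have exp_cvg (u : nat -> R) (l t : R) : u @ \oo --> l ->
    (expR (t * u n))%:E @[n --> \oo] --> (expR (t * l))%:E.
  move=> ul; apply: cvg_EFin; first by near=> n.
  apply: (@cvg_comp _ _ _ (fun n => (t * u n)%R) (@expR R));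
    last exact: continuous_expR.
  by apply: cvgM => //; exact: cvg_cst.
have F0 n w : D w -> 0 <= (expR (s * Gn n w))%:E by rewrite lee_fin expR_ge0.
have mF n : measurable_fun D (fun w => (expR (s * Gn n w))%:E).
  by apply: measurable_laplace; exact: measurable_funTS.
have := fatou P mD mF F0.
rewrite (_ : \int[P]_(x in D) _ = \int[P]_(w in D) (expR (s * G w))%:E);
  last first.
  apply: eq_integral => w /set_mem Dw.
  by have [-> _] := cvg_limn_einf_sup (exp_cvg _ _ s (cG _ Dw)).
move=> /le_trans; apply.
rewrite limn_einf_lim -(cvg_lim _ (exp_cvg _ _ c ce)) //.
apply: lee_lim; [exact: is_cvg_einfs|by apply/cvg_ex; exists (expR (c * e))%:E;
  exact: (exp_cvg _ _ c ce)|].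
move: H; apply: filterS => n; apply: le_trans.
apply: (@le_trans _ _ (\int[P]_(w in D) (expR (s * Gn n w))%:E)).
  by apply: ereal_inf_lbound; exists n => /=.
apply: ge0_subset_integral => //.
  exact: measurable_laplace.
Unshelve. all: by end_near. Qed.

(** Markov's inequality for the exponential; [s] may have either sign, so this serves both tails. *)
Lemma chernoff_set D G s b c : measurable D -> measurable_fun D G ->
  \int[P]_(w in D) (expR (s * G w))%:E <= (expR c)%:E ->
  P (D `&` [set w | (b <= s * G w)%R]) <= (expR (c - b))%:E.
Proof.
move=> mD mG H; set A := _ `&` _.
have mA : measurable A.
  have := measurable_funM (measurable_cst s) mG.
  move=> /(_ mD `[b, +oo[%classic (measurable_itv _)).
  by congr measurable; congr setI; apply/seteqP; split=> w /=;
    rewrite in_itv /= andbT.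
have : (expR b)%:E * P A <= (expR c)%:E.
  apply: le_trans H.
  rewrite -integral_cst //.
  apply: (@le_trans _ _ (\int[P]_(w in A) (expR (s * G w))%:E)).
    apply: ge0_le_integral => //.
    - by move=> w _; rewrite /cst lee_fin expR_ge0.
    - have mGA : measurable_fun A G by apply: (measurable_funS mD _ mG) => w [].
      exact: (measurable_laplace s mGA).
    - by move=> w [_ /= bw]; rewrite lee_fin ler_expR.
  apply: ge0_subset_integral => //.
  - exact: measurable_laplace.
  - by move=> w [].
rewrite -[P A]fineK ?fin_num_measure // -EFinM !lee_fin expRB.
by rewrite ler_pdivlMr ?expR_gt0 // mulrC.
Qed.

Lemma laplace_gt0 D G s : measurable D -> measurable_fun D G -> P D = 1 ->
  0 < \int[P]_(w in D) (expR (s * G w))%:E.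
Proof.
move=> mD mG PD; rewrite lt_def integral_ge0 ?andbT; last first.
  by move=> w _; rewrite lee_fin expR_ge0.
apply/eqP => I0.
have mE := measurable_laplace s mG.
have := (ae_eq_integral_abs P mD mE).1.
have -> : \int[P]_(x in D) `|(expR (s * G x))%:E| = 0.
  by rewrite -[RHS]I0; apply: eq_integral => w _;
    rewrite /= ger0_norm ?expR_ge0.
move=> /(_ erefl) [N [mN N0 DN]].
have DsN : D `<=` N.
  move=> w Dw; apply: DN => /(_ Dw) /eqP; rewrite eqe gt_eqF ?expR_gt0 //.
have : P D <= P N by apply: le_measure; rewrite ?inE.
by rewrite PD N0 lee_fin ler10.
Qed.

End laplace_limits.

(** * The law of the set of occupied cells *)

Section occupied_cells.
Context {R : realType} {d : nat} {disp : measure_display} {Omega :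
  measurableType disp}.
Variables (P : probability Omega R) (mu : {measure set (borelRd R d) ->
  \bar R}).
Variable eta : Omega -> set 'rV[R]_d.
Hypotheses (mulf : locally_finite_measure mu) (pp : poisson_process P mu eta).
Variables (M n : nat).
Local Notation index := {ffun 'I_d -> 'I_(2 * M * n.+1).+1}.
Implicit Types (q : index) (S : {set index}).
Local Open Scope ereal_scope.

Definition occupied w : {set index} :=
  finset (fun q => `[< eta w `&` cell q !=set0 >]).

Definition occ_prob q : R := (1 - expR (- fine (mu (cell q))))%R.

Lemma occ_prob01 q : (0 <= occ_prob q <= 1)%R.
Proof.
rewrite /occ_prob subr_ge0 gerBl expR_ge0 andbT -[leRHS]expR0 ler_expR oppr_le0.
exact: fine_ge0.
Qed.

Lemma occ_prob_le q : (occ_prob q)%:E <= mu (cell q).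
Proof.
have fm : mu (cell q) \is a fin_num.
  by rewrite ge0_fin_numE //; apply: mulf;
    [exact: measurable_cell|exact: bounded_cell].
rewrite -[leRHS]fineK // lee_fin /occ_prob.
by have := expR_ge1Dx (- fine (mu (cell q))); lra.
Qed.

Lemma point_count_eq0 q w : point_count eta (cell q) w = 0 <-> q \notin
  occupied w.
Proof.
have fin : finite_set (eta w `&` cell q) by apply: (pp_locally_finite pp);
  exact: bounded_cell.
rewrite inE /point_count /counting asboolT //;
  split=> [[/eqP]|/asboolP/set0P/negP/negPn/eqP ->].
  rewrite pnatr_eq0 finmap.cardfs_eq0 => /eqP/(fset_set_set0 fin) ->.
  by apply/asboolP => -[].
by rewrite fset_set0.
Qed.

Lemma prob_empty_cell q :
  P (point_count eta (cell q) @^-1` [set 0]) = (1 - occ_prob q)%R%:E.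
Proof.
have fm : mu (cell q) < +oo by apply: mulf;
  [exact: measurable_cell|exact: bounded_cell].
have := pp_poisson pp (measurable_cell q);
  rewrite /poisson_distributed lt_eqF // => /(_ 0%N).
rewrite (_ : [set w | _] = point_count eta (cell q) @^-1` [set 0]) // => ->.
rewrite /poisson_prob /occ_prob opprB addrCA subrr addr0.
(* A cell of measure zero is a separate case: [poisson_prob] is then a Dirac mass at [0]. *)
case: ifPn => [m0|]; first by rewrite esum_set1 /poisson_pmf ?m0 ?expr0 ?fact0
  ?invr1 ?mul1r // lee_fin expR_ge0.
rewrite -leNgt => m0; have -> : fine (mu (cell q)) = 0%R.
  by apply/eqP; rewrite eq_le m0 fine_ge0.
by rewrite oppr0 expR0 diracE mem_set.
Qed.

Lemma measurable_point_count q : measurable_fun setT (point_count eta (cell q)).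
Proof. exact: (pp_measurable pp (measurable_cell q)). Qed.

Lemma measurable_empty_cell q : measurable (point_count eta (cell q) @^-1` [set
  0]).
Proof.
by rewrite -[X in measurable X]setTI; exact: (measurable_point_count q
  measurableT (emeasurable_set1 _)).
Qed.

Let occ_event q (b : bool) : set (\bar R) := if b then ~` [set 0] else [set 0].

Let measurable_occ_event q b : measurable (occ_event q b).
Proof. by case: b; [apply: measurableC|]; exact: emeasurable_set1. Qed.

Lemma prob_occ_event q b : P (point_count eta (cell q) @^-1` occ_event q b) =
  (if b then occ_prob q else 1 - occ_prob q)%R%:E.
Proof.
case: b; last exact: prob_empty_cell.
rewrite /occ_event -preimage_setC probability_setC;
  last exact: measurable_empty_cell.
by rewrite prob_empty_cell -EFinB; congr EFin; ring.
Qed.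

(** The cells are enumerated by an ordinal because the independence of the process is stated for
    families over ['I_n]. *)
Lemma occupiedE S : [set w | occupied w = S] =
  \bigcap_(j in [set: 'I_#|{: index}|])
    (point_count eta (cell (enum_val j)) @^-1` occ_event (enum_val j) (enum_val
      j \in S)).
Proof.
apply/seteqP; split=> w /=.
  move=> <- j _; rewrite /occ_event /=; case: ifPn =>
    [jw /point_count_eq0|/point_count_eq0 //].
  by rewrite jw.
move=> H; apply/finset.setP => q; have := H (enum_rank q) Logic.I.
rewrite /= enum_rankK /occ_event; case: ifPn =>
  [_ /= nq|_ /= /point_count_eq0/negPf //].
by apply/negPn/negP => /point_count_eq0.
Qed.

Lemma prob_occupied S : P [set w | occupied w = S] = (bern_wt occ_prob S)%:E.
Proof.
rewrite occupiedE.
have mA (i : 'I_#|{: index}|) : measurable (cell (enum_val i) : set (borelRd R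
  d)) by exact: measurable_cell.
have tA : trivIset [set: 'I_#|{: index}|] (fun i =>
  cell (enum_val i) : set (borelRd R d)).
  move=> i j _ _ ij; apply: enum_val_inj.
  exact: (@trivIset_cell R d M n (enum_val i) (enum_val j) Logic.I Logic.I ij).
have := @pp_independent _ _ _ _ _ _ _ pp _ _ mA tA (fun i =>
  occ_event (enum_val i) (enum_val i \in S)).
move=> ->; last by move=> i; exact: measurable_occ_event.
rewrite (eq_bigr (fun i => (if enum_val i \in S then occ_prob (enum_val i) else
  1 - occ_prob (enum_val i))%R%:E)); last first.
  by move=> i _; exact: prob_occ_event.
by rewrite prodEFin /bern_wt [in RHS]big_enum_val.
Qed.

Lemma measurable_occupied S : measurable [set w | occupied w = S].
Proof.
rewrite occupiedE; apply: fin_bigcap_measurable => [|j _];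
  first exact: finite_finset.
rewrite -[X in measurable X]setTI.
exact: (measurable_point_count _ measurableT (measurable_occ_event _ _)).
Qed.

Lemma measurable_fun_occupied (h : {set index} -> R) :
  measurable_fun setT (fun w => h (occupied w)).
Proof.
move=> _ B mB; rewrite setTI.
rewrite (_ : _ @^-1` B = \bigcup_(S in [set S | B (h S)]) [set w | occupied w =
  S]).
  by apply: fin_bigcup_measurable => [|S _];
    [exact: finite_finset|exact: measurable_occupied].
by apply/seteqP; split=> [w Bw|w [S /= BS wS]];
  [exists (occupied w)|rewrite /= wS].
Qed.

Lemma integral_occupied (h : {set index} -> R) : (forall S, (0 <= h S)%R) ->
  \int[P]_w (h (occupied w))%:E = (bern_mean occ_prob h)%:E.
Proof.
move=> h0.
transitivity (\int[P]_w \sum_(S : {set index}) (h S)%:E * (\1_[set w | occupied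
  w = S] w)%:E).
  apply: eq_integral => w _; rewrite (bigD1 (occupied w)) //= big1 => [|S nS].
    by rewrite adde0 indicE mem_set // mule1.
  by rewrite indicE memNset ?mule0 //= => wS; rewrite wS eqxx in nS.
rewrite ge0_integral_sum //; last 2 first.
- move=> S; apply/measurable_EFinP; apply: measurable_funM => //.
  by apply: measurable_indic; exact: measurable_occupied.
- by move=> S w _; rewrite -EFinM lee_fin mulr_ge0.
rewrite /bern_mean -sumEFin; apply: eq_bigr => S _.
rewrite ge0_integralZl ?lee_fin //; last first.
  by apply/measurable_EFinP; apply: measurable_indic;
    exact: measurable_occupied.
rewrite integral_indic //; last exact: measurable_occupied.
rewrite setIT mulrC EFinM; congr (_ * _).
exact: prob_occupied.
Qed.

End occupied_cells.

(** * Discretised component counts *)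

Section windows.
Context {R : realType} {d : nat}.
Variable Q : forall T : Type, set T -> (T -> T -> Prop) -> Prop.
Arguments Q {T}.
Hypothesis Qiso : forall (T U : Type) (C : set T) E (D : set U) E',
  graph_isomorphic C E D E' -> Q C E -> Q D E'.
Variable k : nat.
Hypothesis Qcard : forall (T : Type) (C : set T) E, Q C E -> (C #<= `I_k)%card.
Variable rho : R.
Hypotheses (d_gt0 : (0 < d)%N) (rho0 : 0 < rho).
Implicit Types (V : set 'rV[R]_d) (m n : nat).

Local Notation E := (@rgg_edge R d rho).

(** These are components of the whole graph that happen to lie in the window, so the family grows
    with [m]. Components of the graph restricted to the window could merge as it grows. *)
Definition window_comps m V : set (set 'rV[R]_d) :=
  [set C | (component V E C /\ Q C E) /\ C `<=` box m].

(* Whether a set of points in [box m] is a component only depends on the points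
   in [box (outer m)]. *)
Definition outer m : nat := (m + (Num.truncn rho).+1)%N.

Lemma outer_ge m : m%:R + rho <= (outer m)%:R.
Proof. by rewrite natrD lerD2l ltW // truncnS_gt. Qed.

Lemma window_comps_restrict m V : window_comps m V = window_comps m (V `&` box
  (outer m)).
Proof.
apply/seteqP; split=> C [[cC QC] CW]; split => //; split => //.
  apply: (component_setD _ _ cC) => [x Cx|x []//]; split;
    first by case: cC => _ CV _ _; exact: CV.
  move=> i; apply: le_trans (CW _ Cx i) _.
  by apply: le_trans (outer_ge m); rewrite lerDl ltW.
apply: component_setU cC => [x []//|x y Cx Vy nVy [_ xy]].
apply: nVy; split => // i; apply: le_trans (outer_ge m).
have := CW _ Cx i; have := coord_le_enorm (x - y) i; rewrite !mxE => h1 h2.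
have := ler_normB (x ord0 i) (x ord0 i - y ord0 i); rewrite subKr => h3.
by apply: le_trans h3 _; apply: lerD => //; exact: le_trans h1 xy.
Qed.

Local Notation index m n := {ffun 'I_d -> 'I_(2 * outer m * n.+1).+1}.

Definition cell_good m n (C : {set index m n}) : Prop :=
  Q [set` C] (@cell_edge R d (outer m) n rho) /\
  forall i, i \in C -> `[< exists y, @cell R d (outer m) n i y /\ box m y >].

Definition level_count m n (S : {set index m n}) : nat :=
  #|comps (@cell_edge R d (outer m) n rho) (@cell_good m n) S|.

(** An exact equality from some mesh on, which depends on [V]. Points at distance at most [rho] in
    distinct cells are adjacent as cells at every mesh; injectivity, the converse for adjacency and
    the window condition need a fine one. *)
Lemma near_level_count m V : (forall A, bounded_set A ->
  finite_set (V `&` A)) ->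
  \forall n \near \oo, counting (window_comps m V) =
    (level_count (finset (fun q : index m n =>
      `[< V `&` cell q !=set0 >])))%:R%:E :> \bar R.
Proof.
move=> Vfin; rewrite window_comps_restrict.
set V' := V `&` box (outer m).
have V'fin : finite_set V' by apply: Vfin; exact: bounded_box.
have V'b : V' `<=` box (outer m) by move=> x [].
have N1 := near_cell_index_inj V'fin V'b.
have N2 := near_cell_far V'fin V'b rho.
have N3 := near_cell_window V'fin V'b m.
near=> n.
have H1 : forall x, V' x -> forall y, V' y ->
    cell_index (outer m) n x = cell_index (outer m) n y -> x = y by near: n;
      exact: N1.
have H2 : forall x, V' x -> forall y, V' y -> rho < enorm (x - y) ->
    ~~ cell_edge rho (cell_index (outer m) n x) (cell_index (outer m) n y).
  by near: n; exact: N2.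
have H3 : forall x, V' x -> (exists y : 'rV[R]_d,
  cell (cell_index (outer m) n x) y /\ box m y) -> box m x.
  by near: n; exact: N3.
rewrite /level_count /cell_good.
apply: (counting_comps Qiso R (g := cell_index (outer m) n)
  (w := fun i => `[< exists y : 'rV[R]_d, cell i y /\ box m y >])).
- by move=> x y V'x V'y; exact: H1.
- apply/seteqP; split=> [q|_ [x [Vx bx] <-]] /=; rewrite inE.
    by move=> /asboolP[y [Vy [By yq]]]; exists y.
  by apply/asboolP; exists x; split => //; split.
- move=> x y V'x V'y; split=> [[xy xyrho]|/andP[gxy exy]].
    apply/andP; split; first by apply/eqP => /(H1 _ V'x _ V'y).
    by apply/asboolP; exists x, y; split => //; split => //; exact: V'b.
  split; first by move=> xy; rewrite xy eqxx in gxy.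
  rewrite leNgt; apply/negP => /(H2 _ V'x _ V'y); rewrite /cell_edge /= gxy /=.
  by rewrite exy.
- move=> x V'x; split=> [bx|/asboolP]; last exact: H3.
  by apply/asboolP; exists x; split => //; split => //; exact: V'b.
Unshelve. all: by end_near. Qed.

Lemma level_count_le m (L : nat) : (outer m)%:R <= L%:R * rho ->
  forall n (S : {set index m n}), (forall q, q \in S ->
    @cell R d (outer m) n q !=set0) ->
  (level_count S <= (2 * L * d).+1 ^ d)%N.
Proof.
move=> mL n S S0; rewrite /level_count.
have [||J [<- J0 Jind]] := @comps_transversal _ (@cell_edge R d (outer m) n
  rho) (@cell_good m n) S
  (comps (@cell_edge R d (outer m) n rho) (@cell_good m n) S) (fun q =>
    `[< @cell R d (outer m) n q !=set0 >]).
- by [].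
- move=> C /compsP[[[x Cx] CS _ _] _]; exists x => //.
  by apply/asboolP; apply: S0; exact: CS.
- by apply: (card_independent_box d_gt0 rho0 mL) Jind => q /J0 /asboolP.
Qed.

(** * Exponential moments at a fixed window and mesh *)

Section level_laplace.
Variable mu : {measure set (borelRd R d) -> \bar R}.
Hypothesis mufin : (sup_ball_measure mu rho < +oo)%E.
Variables (m n : nat).
Hypothesis nrho : 2 <= n.+1%:R * rho.
Variable p : index m n -> R.
Hypothesis p01 : forall q, 0 <= p q <= 1.
Hypothesis pmu : forall q, ((p q)%:E <= mu (cell q))%E.

Let N : nat := (2 * 2 * d).+1 ^ d.
Let c : R := N%:R ^+ 2.
Let sigma : R := fine (sup_ball_measure mu rho).
Let a : R := k%:R * (c ^+ 2 * sigma + 1).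
Let f (S : {set index m n}) : R := (level_count S)%:R.

Let sigma0 : 0 <= sigma.
Proof.
apply: fine_ge0; apply: le_trans (measure_ge0 mu (closed_eball 0 rho)) _.
by apply: ereal_sup_ubound; exists 0.
Qed.

Let N1 : (1 : R) <= N%:R.
Proof. by rewrite ler1n expn_gt0. Qed.

Let c1 : 1 <= c. Proof. by rewrite /c expr_ge1 // (le_trans ler01). Qed.

Let good_card (C : {set index m n}) : cell_good C -> (#|C| <= k)%N.
Proof.
move=> [/Qcard Ck _]; rewrite -card_le_II; apply: card_le_trans Ck.
by rewrite -(card_le_eql (card_set_pred C)).
Qed.

Let nbr (i : index m n) (J : {set index m n}) :
  (forall x, x \in J -> cell_edge rho x i) ->
    independent_set (cell_edge rho) J -> (#|J| <= N)%N.
Proof. exact: card_independent_nbr. Qed.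

Let psig (x : index m n) : \sum_(i | cell_edge rho x i) p i <= N%:R * sigma.
Proof. exact: sum_nbr_le. Qed.

Lemma level_vplus S : vplus p f S <= a * f S.
Proof.
have Nsigma0 : 0 <= N%:R * sigma by rewrite mulr_ge0.
apply: le_trans (comps_vplus p01 Nsigma0 good_card nbr psig S) _.
rewrite /a ler_wpM2r // ler_wpM2l // lerD2r mulrA -exprSr ler_wpM2r //.
rewrite /c -exprM; exact: ler_weXn2l.
Qed.

Lemma level_jump i S : `|f (i |: S)%SET - f (S :\ i)%SET| <= c.
Proof.
apply: le_trans (@comps_jump _ _ (@cell_good m n) R N nbr i S) _.
apply: (@le_trans _ _ N%:R); first by rewrite ler_nat geq_max leqnn andbT
  expn_gt0.
by rewrite /c expr2 ler_peMl // (le_trans ler01).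
Qed.

Lemma level_laplace_upper t : 0 < t -> a * t < 2 ->
  bern_mean p (fun S => expR (t * f S)) <= expR (t / (1 - a * t / 2) *
    bern_mean p f).
Proof.
move=> t0 at2.
have a0 : 0 <= a by rewrite mulr_ge0 // addr_ge0 // mulr_ge0 // sqr_ge0.
rewrite -[leLHS]lnK ?posrE; last by apply: bern_mean_gt0 => // S;
  exact: expR_gt0.
by rewrite ler_expR; exact: (log_laplace_upper p01 level_vplus level_jump).
Qed.

Lemma level_laplace_lower t : let A := Num.max a (4 * c / 3) in
  0 < t -> A * t <= 1 ->
  bern_mean p (fun S => expR (- t * f S)) <= expR (- (t - A * t ^+ 2 / 2) *
    bern_mean p f).
Proof.
move=> A t0 At.
have a0 : 0 <= a by rewrite mulr_ge0 // addr_ge0 // mulr_ge0 // sqr_ge0.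
rewrite -[leLHS]lnK ?posrE; last by apply: bern_mean_gt0 => // S;
  exact: expR_gt0.
rewrite ler_expR; apply: (log_laplace_lower p01 level_vplus level_jump) At =>
  //.
- by rewrite /A le_max lexx.
- exact: le_trans ler01 c1.
- by rewrite /A le_max; apply/orP; right; have := c1; lra.
Qed.

End level_laplace.
End windows.

(** * Concentration *)

Lemma counting_le (R : realType) (T : choiceType) (A B : set T) :
  A `<=` B -> (counting A <= counting B :> \bar R)%E.
Proof.
move=> AB; rewrite /counting; case: (pselect (finite_set B)) => Bf; last first.
  by rewrite [in leRHS]asboolF // leey.
have Af := sub_finite_set AB Bf.
rewrite !asboolT // lee_fin ler_nat; apply: finmap.fsubset_leq_card.
by rewrite -fset_set_sub.
Qed.

Lemma counting_bigcup_cvg (R : realType) (T : choiceType) (A : nat -> set T) :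
  (forall m n, (m <= n)%N -> A m `<=` A n) ->
  counting (A m) @[m --> \oo] --> (counting (\bigcup_m A m) : \bar R).
Proof.
move=> ndA; set B := \bigcup_m A m.
have near_sub (X : set T) : finite_set X -> X `<=` B ->
  \forall m \near \oo, X `<=` A m.
  move=> Xf XB; have : \forall m \near \oo, forall x, X x -> A m x.
    apply: near_finite => // x /XB[m0 _ Am0]; near=> m.
    by apply: (ndA m0) => //; near: m; exact: nbhs_infty_ge.
  by apply: filterS => m.
have [Bf|Binf] := pselect (finite_set B).
  apply: cvg_near_cst; have := near_sub _ Bf (@subset_refl _ B);
    apply: filterS => m BA.
  by congr counting; apply/seteqP; split=> // x Ax; exists m.
rewrite {2}/counting asboolF //; apply/cvgeyPge => t.
have [X XB cX] := infinite_set_fset (Num.truncn t).+1 Binf.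
have := near_sub _ (finite_fset X) XB; apply: filterS => m XA.
apply: le_trans (counting_le R XA).
rewrite /counting asboolT ?set_fsetK; last exact: finite_fset.
by rewrite lee_fin (le_trans (ltW (truncnS_gt t))) // ler_nat.
Unshelve. all: by end_near. Qed.

Section concentration.
Context {R : realType} {d : nat} {disp : measure_display} {Omega :
  measurableType disp}.
Variable Q : forall T : Type, set T -> (T -> T -> Prop) -> Prop.
Arguments Q {T}.
Hypothesis Qiso : forall (T U : Type) (C : set T) E (D : set U) E',
  graph_isomorphic C E D E' -> Q C E -> Q D E'.
Variable k : nat.
Hypothesis Qcard : forall (T : Type) (C : set T) E, Q C E -> (C #<= `I_k)%card.
Hypothesis k_gt0 : (0 < k)%N.
Variable rho : R.
Hypotheses (d_gt0 : (0 < d)%N) (rho0 : 0 < rho).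
Variables (P : probability Omega R) (mu : {measure set (borelRd R d) ->
  \bar R}).
Variable eta : Omega -> set 'rV[R]_d.
Hypotheses (mulf : locally_finite_measure mu) (pp : poisson_process P mu eta).
Hypothesis mufin : (sup_ball_measure mu rho < +oo)%E.

Let F (w : Omega) : \bar R := counting [set C | component (eta w) (rgg_edge
  rho) C /\ Q C (rgg_edge rho)].
Hypothesis Ffin : {ae P, forall w, (F w < +oo)%E}.
Hypothesis Fpos : (0 < \int[P]_w F w)%E.

Let c : R := ((2 * 2 * d).+1 ^ d)%:R ^+ 2.
Let sigma : R := fine (sup_ball_measure mu rho).
Let a : R := k%:R * (c ^+ 2 * sigma + 1).
Let A : R := Num.max a (4 * c / 3).

Let a_ge1 : 1 <= a.
Proof.
have s0 : 0 <= sigma.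
  apply: fine_ge0; apply: le_trans (measure_ge0 mu (closed_eball 0 rho)) _.
  by apply: ereal_sup_ubound; exists 0.
have k1 : (1 : R) <= k%:R by rewrite ler1n.
have : 0 <= c ^+ 2 * sigma by rewrite mulr_ge0 ?sqr_ge0.
rewrite /a; move: (c ^+ 2 * _) => x x0; nra.
Qed.

Let A_ge1 : 1 <= A. Proof. by rewrite /A le_max a_ge1. Qed.

(* The pairs [(s, x)] for which [E (expR (s * F)) <= expR (x * E F)] is shown. *)
Let adm (s x : R) : Prop :=
  (exists t, [/\ 0 < t, a * t < 2, s = t & x = t / (1 - a * t / 2)]) \/
  (exists t, [/\ 0 < t, A * t <= 1, s = - t & x = - (t - A * t ^+ 2 / 2)]).

Let f m n w : R :=
  (@level_count R d (@Q) rho m n (occupied eta (outer rho m) n w))%:R.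

Let G m w : R := fine (counting (window_comps (@Q) rho m (eta w)) : \bar R).

Let near_f m w : \forall n \near \oo,
  counting (window_comps (@Q) rho m (eta w)) = (f m n w)%:E.
Proof.
by apply: (near_level_count Qiso rho0) => B; exact: (pp_locally_finite pp).
Qed.

Let GE m w : counting (window_comps (@Q) rho m (eta w)) = (G m w)%:E.
Proof.
have [n Hn] := filter_ex (near_f m w).
by rewrite /G Hn.
Qed.

Let f_cvg m w : f m n w @[n --> \oo] --> G m w.
Proof.
apply: cvg_near_cst; have := near_f m w; apply: filterS => n.
by rewrite GE => -[].
Qed.

Let mf m n : measurable_fun setT (f m n).
Proof. exact: (measurable_fun_occupied pp (fun S =>
  (@level_count R d (@Q) rho m n S)%:R)). Qed.

Let mG m : measurable_fun setT (G m).
Proof. by apply: (measurable_fun_cvg (mf m)) => w _; exact: f_cvg. Qed.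

Let f_bound m : exists K : R, forall n w, `|f m n w| <= K.
Proof.
pose L := (Num.truncn ((outer rho m)%:R / rho)).+1.
have mL : (outer rho m)%:R <= L%:R * rho by rewrite -ler_pdivrMr // ltW //
  truncnS_gt.
exists ((2 * L * d).+1 ^ d)%:R => n w.
rewrite ger0_norm // ler_nat; apply: (level_count_le (@Q) d_gt0 rho0 mL) => q.
by rewrite inE => /asboolP[y [_ cy]]; exists y.
Qed.

Let Ef m n : R := bern_mean (occ_prob mu (M := outer rho m) (n := n))
  (fun S => (level_count (@Q) S)%:R).

Let int_f m n : (\int[P]_w (f m n w)%:E = (Ef m n)%:E)%E.
Proof. by rewrite /f (integral_occupied mulf pp (h :=
  fun S => (@level_count R d (@Q) rho m n S)%:R)). Qed.

Let EG m : R := fine (\int[P]_w (G m w)%:E)%E.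

Let G0 m w : 0 <= G m w.
Proof. by apply: fine_ge0; rewrite /counting; case: ifPn;
  rewrite ?leey // lee_fin. Qed.

(** Dominated convergence, with the constant of [f_bound], which is uniform in the mesh. Convergence
    of the means is needed because they appear on the right of the exponential bounds. *)
Let int_G m : P.-integrable setT (EFin \o G m) /\ Ef m n @[n --> \oo] --> EG m.
Proof.
have [K HK] := f_bound m.
have := @dominated_convergence _ _ _ P setT measurableT (fun n w =>
  (f m n w)%:E)
  (EFin \o G m) (EFin \o cst K).
case.
- by move=> n; apply/measurable_EFinP; exact: mf.
- by apply/measurable_EFinP; exact: mG.
- by apply: aeW => w _; apply: cvg_EFin; [near=> n|exact: f_cvg].
- exact: finite_measure_integrable_cst.
- by apply: aeW => w n _ /=; rewrite lee_fin; exact: HK.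
move=> iG _ cG; split => //.
have finG : (\int[P]_w (G m w)%:E)%E \is a fin_num by apply: integrable_fin_num
  iG.
have : (Ef m n)%:E @[n --> \oo] --> (EG m)%:E.
  rewrite /EG fineK //; apply: cvg_trans cG.
  by apply: near_eq_cvg; near=> n; rewrite /= int_f.
exact: fine_cvg.
Unshelve. all: by end_near. Qed.

Let laplace_f m s x : adm s x -> \forall n \near \oo,
  (\int[P]_w (expR (s * f m n w))%:E <= (expR (x * Ef m n))%:E)%E.
Proof.
move=> sx; have r0 : 0 < rho / 2 by rewrite divr_gt0.
have := near_infty_natSinv_lt (PosNum r0); apply: filterS => n /= nr.
have nrho : 2 <= n.+1%:R * rho.
  move: nr; rewrite -div1r ltr_pdivrMr //; lra.
rewrite (integral_occupied mulf pp (h :=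
  fun S => expR (s * (@level_count R d (@Q) rho m n S)%:R))); last first.
  by move=> S; exact: expR_ge0.
rewrite lee_fin.
have p01 := @occ_prob01 R d mu (outer rho m) n.
have pmu := @occ_prob_le R d mu mulf (outer rho m) n.
case: sx => -[t [t0 ta -> ->]].
- exact: (level_laplace_upper Qcard d_gt0 rho0 mufin nrho p01 pmu t0 ta).
- exact: (level_laplace_lower Qcard d_gt0 rho0 mufin nrho p01 pmu t0 ta).
Qed.

Let laplace_G m s x : adm s x ->
  (\int[P]_w (expR (s * G m w))%:E <= (expR (x * EG m))%:E)%E.
Proof.
move=> sx; apply: (laplace_fatou measurableT (mf m) _ (int_G m).2 (laplace_f m
  sx)) => w _.
exact: f_cvg.
Qed.

(** A counted component has at most [k] points, hence is bounded and lies in some window. *)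
Let F_bigcup w : \bigcup_m window_comps (@Q) rho m (eta w) =
  [set C | component (eta w) (rgg_edge rho) C /\ Q C (rgg_edge rho)].
Proof.
apply/seteqP; split=> [C [m _ []//]|C [cC QC]].
have Cfin : finite_set C by apply/finite_set_leP; exists k; exact: Qcard QC.
have : \forall m \near \oo, forall x, C x -> @box R d m x.
  apply: near_finite => // x _; near=> m => i.
  apply: (@le_trans _ _ `|x|); last by near: m; exact: nbhs_infty_ger.
  rewrite /Num.norm /= mx_normrE; apply/bigmax_geP; right => /=.
  by exists (ord0, i).
move=> /filter_ex[m Cm]; exists m => //.
Unshelve. all: by end_near. Qed.

Let window_comps_nd w m n : (m <= n)%N ->
  window_comps (@Q) rho m (eta w) `<=` window_comps (@Q) rho n (eta w).
Proof.
move=> mn C [QC Cm]; split => // x /Cm Bx i.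
by apply: le_trans (Bx i) _; rewrite ler_nat.
Qed.

Let G_cvg w : (G m w)%:E @[m --> \oo] --> F w.
Proof.
rewrite /F -F_bigcup.
have cA := @counting_bigcup_cvg R _ (fun m =>
  window_comps (@Q) rho m (eta w)) (@window_comps_nd w).
apply: cvg_trans cA.
by apply: near_eq_cvg; near=> m; rewrite GE.
Unshelve. all: by end_near. Qed.

Let G_nd w : nondecreasing_seq (fun m => (G m w)%:E).
Proof. by move=> m n mn; rewrite -!GE; apply: counting_le;
  exact: window_comps_nd. Qed.

Let G_le m w : ((G m w)%:E <= F w)%E.
Proof.
rewrite -GE /F; apply: counting_le => C [[cC QC] _]; exact: conj cC QC.
Qed.

Let F0 w : (0 <= F w)%E.
Proof. by apply: le_trans (G_le 0 w); rewrite lee_fin. Qed.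

Let mF : measurable_fun setT F.
Proof.
apply: (emeasurable_fun_cvg (fun m w => (G m w)%:E)) => [m|w _].
  by apply/measurable_EFinP; exact: mG.
exact: G_cvg.
Qed.

Let D : set Omega := [set w | (F w < +oo)%E].

Let mD : measurable D.
Proof.
rewrite (_ : D = setT `&` F @^-1` [set x | (x < +oo)%E]); last by rewrite setTI.
apply: mF => //.
rewrite (_ : [set x : \bar R | _] = ~` [set +oo%E]);
  first by apply: measurableC; exact: emeasurable_set1.
by apply/seteqP; split=> x /=; rewrite ltey => /eqP.
Qed.

Let PDC : P (~` D) = 0%E.
Proof.
have [N [mN N0 DN]] := Ffin.
apply/eqP; rewrite eq_le measure_ge0 andbT -N0.
by apply: le_measure; rewrite ?inE //; exact: measurableC.
Qed.

Let PD : P D = 1%E.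
Proof. by have := probability_setC P (measurableC mD);
  rewrite setCK PDC sube0. Qed.

Let int_G_cvg : (\int[P]_w (G m w)%:E @[m --> \oo] --> \int[P]_w F w)%E.
Proof.
have := @cvg_monotone_convergence _ _ _ P setT measurableT (fun m w =>
  (G m w)%:E).
rewrite (_ : (\int[P]_(x in _) _)%E = (\int[P]_w F w)%E); last first.
  by apply: eq_integral => w _; apply/cvg_lim => //; exact: G_cvg.
apply.
- by move=> m; apply/measurable_EFinP; exact: mG.
- by move=> m w _; rewrite lee_fin.
- by move=> w _; exact: G_nd.
Qed.

Let F' w : R := fine (F w).

Let mF' : measurable_fun D F'.
Proof. by apply: measurableT_comp => //; exact: measurable_funTS. Qed.

Let F'E w : D w -> F w = (F' w)%:E.
Proof. by move=> Dw; rewrite fineK // ge0_fin_numE. Qed.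

Let G_cvg' w : D w -> G m w @[m --> \oo] --> F' w.
Proof. by move=> /F'E FE; have := @G_cvg w; rewrite FE => /fine_cvg. Qed.

Let EG_E m : (\int[P]_w (G m w)%:E = (EG m)%:E)%E.
Proof. by rewrite fineK //; exact: integrable_fin_num (int_G m).1. Qed.

(** The lower bound at the endpoint [t = 1 / A] gives [del <= expR (- EG m / (2 A))], where [del],
    the mean of [expR (- F / A)], is positive because [F] is almost surely finite. This bounds
    [EG m] uniformly in [m], and monotone convergence concludes. *)
Lemma component_count_integral_lty : (\int[P]_w F w < +oo)%E.
Proof.
have t0 : 0 < A^-1 by rewrite invr_gt0 (lt_le_trans ltr01).
have A0 : 0 < A by exact: lt_le_trans ltr01 A_ge1.
pose x := - (A^-1 - A * A^-1 ^+ 2 / 2).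
have xE : x = - (A^-1 / 2) by rewrite /x; field; rewrite gt_eqF.
have sx : adm (- A^-1) x by right; exists A^-1; split=> //;
  rewrite mulfV // gt_eqF.
set del := (\int[P]_(w in D) (expR (- A^-1 * F' w))%:E)%E.
have del0 : (0 < del)%E by exact: laplace_gt0.
have delG m : (del <= (expR (x * EG m))%:E)%E.
  apply: le_trans (laplace_G m sx).
  apply: (@le_trans _ _ (\int[P]_(w in D) (expR (- A^-1 * G m w))%:E)%E).
    apply: ge0_le_integral => //.
    - exact: measurable_laplace.
    - by apply: measurable_laplace; exact: measurable_funTS.
    - move=> w Dw; rewrite lee_fin ler_expR ler_nM2l ?oppr_lt0 // -lee_fin -F'E
      //.
  apply: ge0_subset_integral => //; first exact: measurable_laplace.
have delfin : del \is a fin_num.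
  rewrite ge0_fin_numE ?ltW //; apply: le_lt_trans (delG 0%N) _; exact: ltry.
pose B := - ln (fine del) * 2 * A.
have EGB m : EG m <= B.
  have := delG m; rewrite -(fineK delfin) lee_fin => H.
  have d0 : 0 < fine del by rewrite fine_gt0 // del0 ltey_eq delfin.
  move: H; rewrite -[fine del]lnK ?posrE // ler_expR xE /B.
  have -> : - (A^-1 / 2) * EG m = - (EG m / (2 * A)) by field; rewrite gt_eqF.
  rewrite lerNr => H; rewrite -mulrA -ler_pdivrMr ?mulr_gt0 //.
apply: (@le_lt_trans _ _ B%:E); last exact: ltry.
apply: (cvge_to_le int_G_cvg); near=> m.
by rewrite EG_E lee_fin.
Unshelve. all: by end_near. Qed.

Let EF : R := fine (\int[P]_w F w)%E.

Let int_F : (\int[P]_w F w = EF%:E)%E.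
Proof.
by rewrite fineK // ge0_fin_numE ?component_count_integral_lty // integral_ge0.
Qed.

Let EF_gt0 : 0 < EF. Proof. by move: Fpos; rewrite int_F lte_fin. Qed.

Lemma component_count_integrable : P.-integrable setT F.
Proof.
apply/integrableP; split => //.
under eq_integral do rewrite gee0_abs //.
exact: component_count_integral_lty.
Qed.

Let laplace_F s x : adm s x ->
  (\int[P]_(w in D) (expR (s * F' w))%:E <= (expR (x * EF))%:E)%E.
Proof.
move=> sx; apply: (laplace_fatou mD mG G_cvg' (en := EG)); last first.
  by near=> m; exact: laplace_G.
have := int_G_cvg; rewrite int_F; under eq_fun do rewrite EG_E.
exact: fine_cvg.
Unshelve. all: by end_near. Qed.

Let prob_D (S : set Omega) : measurable S -> P S = P (D `&` S).
Proof.
move=> mS; rewrite -[in LHS](setIT S) -(setUv D) setIUr measureU.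
- rewrite [X in (_ + X)%E](_ : _ = 0%E) ?adde0 1?setIC //.
  apply/eqP; rewrite eq_le measure_ge0 andbT -PDC.
  by apply: le_measure; rewrite ?inE; [apply: measurableI => //;
    exact: measurableC|exact: measurableC|move=> w []].
- exact: measurableI.
- by apply: measurableI => //; exact: measurableC.
- by apply/seteqP; split=> w // [[_ h] [_ /(_ h)]].
Qed.

Let measurable_ge (b : R) : measurable [set w | (b%:E <= F w)%E].
Proof. by rewrite -[X in measurable X]setTI;
  exact: emeasurable_fun_c_infty. Qed.

Let measurable_le (b : R) : measurable [set w | (F w <= b%:E)%E].
Proof. by rewrite -[X in measurable X]setTI;
  exact: emeasurable_fun_infty_c. Qed.

Lemma component_count_upper (r : R) : 0 <= r ->
  (P [set w | (EF + r)%:E <= F w] <= (expR (- (r ^+ 2 / (a * (2 * EF +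
    r)))))%:E)%E.
Proof.
move=> r0; have [->|rn0] := eqVneq r 0.
  by rewrite expr0n mul0r oppr0 expR0; exact: probability_le1.
have rp : 0 < r by rewrite lt_def rn0.
have ap : 0 < a by exact: lt_le_trans ltr01 a_ge1.
have s0 : 0 < 2 * EF + r by rewrite addr_gt0 // mulr_gt0.
have aN : a != 0 by rewrite gt_eqF.
have sN : 2 * EF + r != 0 by rewrite gt_eqF.
have EN : EF != 0 by rewrite gt_eqF.
have den : 0 < a * (2 * EF + r) by rewrite mulr_gt0.
(* The exact minimiser satisfies [1 - a t / 2 = 1 / sqrt (1 + r / EF)]; replacing the root by
   [1 + r / (2 EF)] gives this rational [t] and exactly the claimed exponent. *)
pose t := 2 * r / (a * (2 * EF + r)).
have t0 : 0 < t by rewrite divr_gt0 // mulr_gt0.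
have at2 : a * t < 2.
  have -> : a * t = 2 * r / (2 * EF + r).
    by rewrite /t; field; rewrite ?aN ?sN ?EN.
  by rewrite ltr_pdivrMr // ltr_pM2l //; have := EF_gt0; lra.
have sx : adm t (t / (1 - a * t / 2)) by left; exists t.
rewrite prob_D; last exact: measurable_ge.
rewrite (_ : _ `&` _ = D `&` [set w | t * (EF + r) <= t * F' w]); last first.
  by apply/seteqP; split=> w [Dw /= h]; split => //; move: h;
    rewrite /= F'E // lee_fin ler_pM2l.
apply: le_trans (chernoff_set _ mD mF' (laplace_F sx)) _.
rewrite lee_fin ler_expR le_eqVlt; apply/orP; left; apply/eqP.
have -> : 1 - a * t / 2 = 2 * EF / (2 * EF + r).
  by rewrite /t; field; rewrite ?aN ?sN ?EN.
by rewrite /t; field; rewrite ?aN ?sN ?EN.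
Qed.

Lemma component_count_lower (r : R) : 0 <= r ->
  (P [set w | F w <= (EF - r)%:E] <= (expR (- (r ^+ 2 / (2 * A * EF))))%:E)%E.
Proof.
move=> r0; have [->|rn0] := eqVneq r 0.
  by rewrite expr0n mul0r oppr0 expR0; exact: probability_le1.
have rp : 0 < r by rewrite lt_def rn0.
have A0 : 0 < A by exact: lt_le_trans ltr01 A_ge1.
(* For [r > EF] the event would force [F < 0]. *)
have [rE|Er] := leP r EF; last first.
  rewrite (_ : [set w | _] = set0) ?measure0 ?lee_fin ?expR_ge0 //.
  apply/seteqP; split=> w //= h; have := le_trans (F0 w) h.
  by rewrite lee_fin subr_ge0 leNgt Er.
(* The minimiser of [A t^2 EF / 2 - t r]; it is admissible, [A * t <= 1], exactly when [r <= EF]. *)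
pose t := r / (A * EF).
have t0 : 0 < t by rewrite divr_gt0 // mulr_gt0.
have At1 : A * t <= 1.
  have -> : A * t = r / EF by rewrite /t; field; rewrite !gt_eqF.
  by rewrite ler_pdivrMr // mul1r.
have sx : adm (- t) (- (t - A * t ^+ 2 / 2)) by right; exists t.
rewrite prob_D; last exact: measurable_le.
rewrite (_ : _ `&` _ = D `&` [set w | - t * (EF - r) <= - t * F' w]);
  last first.
  apply/seteqP; split=> w [Dw /= h]; split => //; move: h;
    rewrite /= F'E // lee_fin.
    by rewrite ler_nM2l // oppr_lt0.
  by rewrite ler_nM2l // oppr_lt0.
apply: le_trans (chernoff_set _ mD mF' (laplace_F sx)) _.
rewrite lee_fin ler_expR le_eqVlt; apply/orP; left; apply/eqP.
by rewrite /t; field; rewrite !gt_eqF.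
Qed.

End concentration.

Lemma graph_isomorphic_card_le (T U : Type) (C : set T) E (D : set U) E' :
  graph_isomorphic C E D E' -> (D #<= C)%card.
Proof.
move=> [f [[_ _ surj] _]]; apply: card_le_trans (card_image_le f C).
exact: subset_card_le.
Qed.

Lemma graph_isomorphic_card_eq (T U : Type) (C : set T) E (D : set U) E' :
  graph_isomorphic C E D E' -> (D #= C)%card.
Proof.
move=> [f [[fCD inj surj] _]]; have <- : f @` C = D; last exact: inj_card_eq.
by apply/seteqP; split=> [_ [x Cx <-]|]; [exact: fCD|exact: surj].
Qed.

Lemma graph_isomorphic_trans (S T U : Type) (B : set S) EB (C : set T) EC (D :
  set U) ED :
  graph_isomorphic B EB C EC -> graph_isomorphic C EC D ED ->
  graph_isomorphic B EB D ED.
Proof.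
move=> [f [[fBC finj fsurj] fE]] [g [[gCD ginj gsurj] gE]].
exists (g \o f); split; first split.
- by move=> x Bx; apply: gCD; exact: fBC.
- move=> x y xB yB /= gfxy; apply: finj => //; apply: ginj => //;
  apply/mem_set/fBC; exact/set_mem.
- by move=> z /gsurj[y /fsurj[x Bx <-] <-]; exists x.
- move=> x y Bx By; rewrite fE // gE //; exact: fBC.
Qed.

Theorem theorem1p1 (R : realType) (d : nat) (d_gt0 : (0 < d)%N) :
  exists c : R, 0 < c /\
  forall (disp : measure_display) (Omega : measurableType disp)
    (P : probability Omega R)
    (mu : {measure set (borelRd R d) -> \bar R})
    (eta : Omega -> set 'rV[R]_d) (rho : R) (k : nat) (F : Omega -> \bar R),
  nontrivial mu -> locally_finite_measure mu -> non_atomic mu ->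
  poisson_process P mu eta ->
  0 < rho ->
  (sup_ball_measure mu rho < +oo)%E ->
  (0 < k)%N ->
  [\/ F = (fun w => num_components_le rho k (eta w)),
      F = (fun w => num_components_eq rho k (eta w)) |
      exists (W : finType) (H : rel W),
        [/\ #|W| = k, symmetric H, irreflexive H, graph_connected [set: W] H &
            F = (fun w => num_components_iso rho H (eta w))]] ->
  {ae P, forall w, (F w < +oo)%E} ->
  (0 < \int[P]_w F w)%E ->
  P.-integrable [set: Omega] F /\
  forall r : R, 0 <= r ->
    let EF := fine (\int[P]_w F w)%E in
    let a := k%:R * (c ^+ 2 * fine (sup_ball_measure mu rho) + 1) in
    (P [set w | (EF + r)%:E <= F w] <=
       (expR (- (r ^+ 2 / (a * (2 * EF + r)))))%:E)%E /\
    (P [set w | F w <= (EF - r)%:E] <=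
       (expR (- (r ^+ 2 / (2 * Num.max a (4 * c / 3) * EF))))%:E)%E.
Proof.
exists (((2 * 2 * d).+1 ^ d)%:R ^+ 2); split.
  by rewrite exprn_gt0 // ltr0n expn_gt0.
move=> disp Omega P mu eta rho k F _ mulf _ pp rho0 mufin k0 FE Ffin Fpos.
(* All that the argument uses about the three kinds of components is invariance under isomorphism
   and the bound [k] on the number of vertices. *)
have [Q [Qiso Qcard QF]] : exists Q : forall T : Type, set T -> (T -> T ->
  Prop) -> Prop,
  [/\ forall (T U : Type) (C : set T) E (D : set U) E',
        graph_isomorphic C E D E' -> Q T C E -> Q U D E',
      forall (T : Type) (C : set T) E, Q T C E -> (C #<= `I_k)%card &
      F = fun w => counting [set C | component (eta w) (rgg_edge rho) C /\ Q _
        C (rgg_edge rho)]].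
  case: FE => [->|->|[W [H [Wk _ _ _ ->]]]].
  - exists (fun T C _ => (C #<= `I_k)%card); split => // T U C E D E'.
    by move=> /graph_isomorphic_card_le; exact: card_le_trans.
  - exists (fun T C _ => (C #= `I_k)%card); split => // [T U C E D E'|T C _].
      by move=> /graph_isomorphic_card_eq; exact: card_eq_trans.
    by rewrite card_eq_le => /andP[].
  - exists (fun T C E => graph_isomorphic [set: W] H C E); split => //.
      by move=> T U C E D E' CD WC; exact: graph_isomorphic_trans CD.
    move=> T C E /graph_isomorphic_card_le /card_le_trans; apply.
    rewrite -Wk -cardsT; apply: card_le_trans (_ : [set` finset.setTfor W] #<=
      _)%card.
      by apply: subset_card_le => x _; rewrite /= inE.
    by have := card_set_pred (finset.setTfor W); rewrite card_eq_le => /andP[].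
rewrite QF in Ffin Fpos *; split.
  exact: (component_count_integrable Qiso Qcard k0 d_gt0 rho0 mulf pp mufin
    Ffin).
move=> r r0; split.
  exact: (component_count_upper Qiso Qcard k0 d_gt0 rho0 mulf pp mufin Ffin
    Fpos r0).
exact: (component_count_lower Qiso Qcard k0 d_gt0 rho0 mulf pp mufin Ffin Fpos
  r0).
Qed.
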